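(* For data $(\boldsymbol f_e,f_f,g)\in \mathbf V^*\times V^*\times H^{1/2}(\Gamma_c)$ with $\mathbf K=\mathbf K(g)\neq\emptyset$, there exists exactly one pair $(\boldsymbol u,p)\in\mathbf K\times V$ solving \[ a(\boldsymbol u,\boldsymbol v-\boldsymbol u)-b(\boldsymbol v-\boldsymbol u,p)\ge\langle \boldsymbol f_e,\boldsymbol v-\boldsymbol u\rangle\quad\forall \boldsymbol v\in\mathbf K,\qquad -b(\boldsymbol u,q)-c(p,q)=\langle f_f,q\rangle\quad\forall q\in V. \] Moreover, the solution depends Lipschitz-continuously on the data: if $(\boldsymbol u,p)$ and $(\widetilde{\boldsymbol u},\widetilde p)$ are the solutions for the data $(\boldsymbol f_e,f_f,g)$ and $(\widetilde{\boldsymbol f_e},\widetilde{f_f},\widetilde g)$, respectively (with $\mathbf K(g)$ and $\mathbf K(\widetilde g)$ non-empty), then \[ \left(\|\boldsymbol u-\widetilde{\boldsymbol u}\|_{\mathbf V}^2+\|p-\widetilde p\|_V^2\right)^{1/2}\le \|\boldsymbol f_e-\widetilde{\boldsymbol f_e}\|_{\mathbf V^*}+\|f_f-\widetilde{f_f}\|_{V^*}+3\,\|g-\widetilde g\|_{\mathbf V,\Gamma_c}. \]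
   Context: Setting. $\Omega\subset\mathbb R^d$, $d\in\{2,3\}$, is a bounded Lipschitz domain with boundary $\Gamma$ and outward unit normal $\boldsymbol n$. The boundary is decomposed twice into non-overlapping parts, $\Gamma=\Gamma_p\cup\Gamma_f=\Gamma_c\cup\Gamma_d\cup\Gamma_t$, with $\Gamma_p$ and $\Gamma_d$ of positive surface measure and $\overline{\Gamma_d}\cap\overline{\Gamma_c}=\emptyset$. Parameters: constants $\tau,\iota,\alpha>0$ and a symmetric, uniformly positive definite matrix $\boldsymbol\kappa$ (bounded, $d\times d$). Spaces: $V=\{v\in H^1(\Omega): v|_{\Gamma_p}=0\}$ and $\mathbf V=\{\boldsymbol v\in [H^1(\Omega)]^d:\boldsymbol v|_{\Gamma_d}=\mathbf 0\}$, with duals $V^*$, $\mathbf V^*$ and duality pairings $\langle\cdot,\cdot\rangle$; $(\cdot,\cdot)$ is the $L^2(\Omega)$ inner product. With $\boldsymbol\varepsilon(\boldsymbol u)=\frac12(\nabla\boldsymbol u+\nabla^\top\boldsymbol u)$, the bilinear forms are \[a(\boldsymbol u,\boldsymbol v)=2\tau(\boldsymbol\varepsilon(\boldsymbol u),\boldsymbol\varepsilon(\boldsymbol v))+\iota(\operatorname{div}\boldsymbol u,\operatorname{div}\boldsymbol v),\quad b(\boldsymbol u,q)=\alpha(\operatorname{div}\boldsymbol u,q),\quad c(p,q)=\tfrac{\alpha^2}{\iota}(p,q)+(\boldsymbol\kappa\nabla p,\nabla q).\] Norms: $\|\boldsymbol v\|_{\mathbf V}^2=a(\boldsymbol v,\boldsymbol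 v)$ and $\|q\|_V^2=c(q,q)$ (equivalent to the $H^1$ norms by the Korn and Poincaré inequalities); $\|\cdot\|_{\mathbf V^*}$ and $\|\cdot\|_{V^*}$ are the corresponding dual norms. The normal trace is $\gamma\boldsymbol v=\boldsymbol v|_{\Gamma_c}\cdot\boldsymbol n=:\boldsymbol v_{\boldsymbol n}$; it is a standing assumption that $\gamma$ is a bounded linear map from $\mathbf V$ onto $H^{1/2}(\Gamma_c)$, and for $v\in H^{1/2}(\Gamma_c)$ one sets $\|v\|_{\mathbf V,\Gamma_c}=\inf\{\|\boldsymbol w\|_{\mathbf V}:\boldsymbol w\in\mathbf V,\ \gamma\boldsymbol w=v\}$. For $g\in H^{1/2}(\Gamma_c)$, $\mathbf K=\mathbf K(g)=\{\boldsymbol v\in\mathbf V:\boldsymbol v_{\boldsymbol n}\le g\text{ on }\Gamma_c\}$. *)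

(* Defs.v *)
From HB Require Import structures.
From mathcomp Require Import all_boot all_order all_algebra.
From mathcomp Require Import all_classical all_reals all_analysis.
Import Order.TTheory GRing.Theory Num.Theory.
Import numFieldNormedType.Exports.

Set Implicit Arguments.
Unset Strict Implicit.
Unset Printing Implicit Defensive.

Local Open Scope classical_set_scope.
Local Open Scope ring_scope.

(* The library norm on row vectors is the sup norm; it is only used for the
   topology. All metric quantities use the Euclidean norm below. *)
Section euclidean.
Context {R : realType} {d : nat}.
Implicit Types x y : 'rV[R]_d.

Definition dotp x y : R := \sum_(i < d) x 0 i * y 0 i.

Definition enorm x : R := Num.sqrt (dotp x x).

End euclidean.

Section cover_outer_measure.
Context {R : realType} {T : pointedType}.
Variable zeta : set T -> \bar R.
Local Open Scope ereal_scope.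

Definition cover_outer (A : set T) : \bar R :=
  ereal_inf [set \sum_(k <oo) zeta (F k)
            | F in [set F : (set T)^nat | A `<=` \bigcup_k F k]].

Hypotheses (zeta0 : zeta set0 = 0) (zeta_ge0 : forall A, 0 <= zeta A).

Let all_sets := g_sigma_algebraType [set: set T].

Let cover_outerE : cover_outer = mu_ext (zeta : set all_sets -> \bar R).
Proof.
apply/funext => A; rewrite /cover_outer /mu_ext; congr (ereal_inf _).
congr (image _ _); apply/seteqP; split => F /=; last by case.
by move=> AF; split => // i; apply: sub_sigma_algebra.
Qed.

Lemma cover_outer0 : cover_outer set0 = 0.
Proof. by rewrite cover_outerE; exact: mu_ext0. Qed.

Lemma cover_outer_ge0 A : 0 <= cover_outer A.
Proof. by rewrite cover_outerE; exact: mu_ext_ge0. Qed.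

Lemma le_cover_outer : {homo cover_outer : A B / A `<=` B >-> A <= B}.
Proof. by rewrite cover_outerE; exact: (@le_mu_ext _ all_sets). Qed.

Lemma cover_outer_sigma_subadditive : sigma_subadditive cover_outer.
Proof. by rewrite cover_outerE; exact: (@mu_ext_sigma_subadditive _ all_sets). Qed.

End cover_outer_measure.

Section lebesgue_rV.
Context {R : realType} {d : nat}.
Local Open Scope ereal_scope.

(* +oo on the nonempty sets that are not open boxes *)
Definition box_volume (A : set 'rV[R]_d) : \bar R :=
  ereal_inf ([set v | A = set0 /\ v = 0] `|`
    [set v | exists a b : 'rV[R]_d,
      [/\ forall i, (a 0%R i <= b 0%R i)%R,
          A = [set x | forall i, (a 0%R i < x 0%R i < b 0%R i)%R] &
          v = (\prod_(i < d) (b 0%R i - a 0%R i)%R)%:E]]).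

Lemma box_volume_ge0 A : 0 <= box_volume A.
Proof.
apply: le_ereal_inf_tmp => v [[_ ->//]|[a [b [ab _ ->]]]].
by rewrite lee_fin prodr_ge0// => i _; rewrite subr_ge0.
Qed.

Lemma box_volume0 : box_volume set0 = 0.
Proof.
apply/eqP; rewrite eq_le box_volume_ge0 andbT.
by apply: ereal_inf_lbound; left.
Qed.

(* Lebesgue outer measure on R^d. *)
Definition leb : set 'rV[R]_d -> \bar R := cover_outer box_volume.

HB.instance Definition _ := isOuterMeasure.Build R 'rV[R]_d leb
  (cover_outer0 box_volume0 box_volume_ge0)
  (cover_outer_ge0 box_volume_ge0)
  (@le_cover_outer R 'rV[R]_d box_volume)
  (cover_outer_sigma_subadditive box_volume_ge0).

End lebesgue_rV.
Arguments leb {R d}.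

Section hausdorff.
Context {R : realType} {d : nat}.
Variable s : nat.
Local Open Scope ereal_scope.

Definition unit_ball_volume : R :=
  fine (leb [set x : 'rV[R]_s | (enorm x <= 1)%R]).

Definition diameter (A : set 'rV[R]_d) : \bar R :=
  ereal_sup [set (enorm (z.1 - z.2))%:E | z in A `*` A].

Definition hausdorff_gauge (delta : R) (A : set 'rV[R]_d) : \bar R :=
  if `[< A = set0 >] then 0
  else if diameter A <= delta%:E
       then (unit_ball_volume * (fine (diameter A) / 2) ^+ s)%:E
       else +oo.

Lemma hausdorff_gauge0 delta : hausdorff_gauge delta set0 = 0.
Proof. by rewrite /hausdorff_gauge asboolT. Qed.

Lemma hausdorff_gauge_ge0 delta A : 0 <= hausdorff_gauge delta A.
Proof.
rewrite /hausdorff_gauge; case: asboolP => // /eqP/set0P[x Ax].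
case: ifP => // _; rewrite lee_fin mulr_ge0//.
  exact/fine_ge0/outer_measure_ge0.
rewrite exprn_ge0// divr_ge0// fine_ge0//.
apply: ereal_sup_ubound; exists (x, x) => //=.
rewrite subrr /enorm /dotp big1 ?sqrtr0// => i _.
by rewrite mxE mul0r.
Qed.

(* s-dimensional Hausdorff outer measure on R^d, normalized so that it is the
   usual s-dimensional area. *)
Definition hausdorff (A : set 'rV[R]_d) : \bar R :=
  ereal_sup [set cover_outer (hausdorff_gauge delta) A
            | delta in [set delta : R | (0 < delta)%R]].

Let hausdorff_ub delta A : (0 < delta)%R ->
  cover_outer (hausdorff_gauge delta) A <= hausdorff A.
Proof. by move=> d0; apply: ereal_sup_ubound; exists delta. Qed.

Let hausdorff0 : hausdorff set0 = 0.
Proof.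
apply/eqP; rewrite eq_le; apply/andP; split.
  apply: ge_ereal_sup => _ [e /= e0 <-].
  by rewrite (cover_outer0 (hausdorff_gauge0 e) (hausdorff_gauge_ge0 e)).
apply: le_trans (hausdorff_ub set0 ltr01).
exact/cover_outer_ge0/hausdorff_gauge_ge0.
Qed.

Let hausdorff_ge0 A : 0 <= hausdorff A.
Proof.
apply: le_trans (hausdorff_ub A ltr01).
exact/cover_outer_ge0/hausdorff_gauge_ge0.
Qed.

Let le_hausdorff : {homo hausdorff : A B / A `<=` B >-> A <= B}.
Proof.
move=> A B AB; apply: ge_ereal_sup => _ [e /= e0 <-].
exact: le_trans (le_cover_outer _ AB) (hausdorff_ub B e0).
Qed.

Let hausdorff_sigma_subadditive : sigma_subadditive hausdorff.
Proof.
move=> F; apply: ge_ereal_sup => _ [e /= e0 <-].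
apply: le_trans (cover_outer_sigma_subadditive (hausdorff_gauge_ge0 e) F) _.
apply: lee_nneseries => [k _ _|k _]; last exact: hausdorff_ub.
exact/cover_outer_ge0/hausdorff_gauge_ge0.
Qed.

HB.instance Definition _ := isOuterMeasure.Build R 'rV[R]_d hausdorff
  hausdorff0 hausdorff_ge0 le_hausdorff hausdorff_sigma_subadditive.

End hausdorff.

(* Integrals and measurability below refer to the Caratheodory sigma-algebras
   of the two outer measures. *)
Section measures.
Variables (R : realType) (d : nat).

Definition leb_outer : {outer_measure set 'rV[R]_d -> \bar R} := leb.

Definition surf_outer : {outer_measure set 'rV[R]_d -> \bar R} :=
  hausdorff d.-1.

Definition dx : {measure set (caratheodory_type leb_outer) -> \bar R} :=
  (leb_outer : set (caratheodory_type leb_outer) -> \bar R).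

Definition surf : {measure set (caratheodory_type surf_outer) -> \bar R} :=
  (surf_outer : set (caratheodory_type surf_outer) -> \bar R).

End measures.
Notation lebesgueT R d := (caratheodory_type (leb_outer R d)).
Notation surfaceT R d := (caratheodory_type (surf_outer R d)).

Section geometry.
Context {R : realType} {d : nat}.
Implicit Types (Omega : set 'rV[R]_d) (x y n : 'rV[R]_d).

Definition boundary Omega : set 'rV[R]_d := closure Omega `\` interior Omega.

(* Near each boundary point, Omega is the strict epigraph, in some direction e,
   of a Lipschitz function phi of the component orthogonal to e. *)
Definition lipschitz_boundary Omega := forall x, boundary Omega x ->
  exists (r : R) (e : 'rV[R]_d) (phi : 'rV[R]_d -> R) (L : R),
    [/\ 0 < r, enorm e = 1,
        forall y z, `|phi y - phi z| <= L * enorm (y - z) &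
        forall y, enorm (y - x) < r ->
          (Omega y <-> phi (y - dotp y e *: e) < dotp y e)].

Definition lipschitz_domain Omega :=
  [/\ open Omega, connected Omega, Omega !=set0, bounded_set Omega &
      lipschitz_boundary Omega].

(* Near x, Omega agrees with the half-space {y | (y - x).n < 0} up to cones of
   arbitrarily small opening around its boundary plane. There is at most one
   such unit vector, and for a Lipschitz domain it exists at almost every
   boundary point. *)
Definition is_outer_normal Omega x n := enorm n = 1 /\
  forall eps : R, 0 < eps -> \forall y \near x,
    (dotp (y - x) n < - eps * enorm (y - x) -> Omega y) /\
    (eps * enorm (y - x) < dotp (y - x) n -> ~ Omega y).

Definition outer_normal Omega x : 'rV[R]_d :=
  xget 0 [set n | is_outer_normal Omega x n].

Definition decomposition2 Omega (A B : set 'rV[R]_d) :=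
  [/\ measurable (A : set (surfaceT R d)), measurable (B : set (surfaceT R d)),
      boundary Omega = A `|` B & surf R d (A `&` B) = 0%E].

Definition decomposition3 Omega (A B C : set 'rV[R]_d) :=
  [/\ measurable (A : set (surfaceT R d)), measurable (B : set (surfaceT R d)),
      measurable (C : set (surfaceT R d)),
      boundary Omega = A `|` B `|` C &
      [/\ surf R d (A `&` B) = 0%E, surf R d (A `&` C) = 0%E &
          surf R d (B `&` C) = 0%E]].

End geometry.

Section smooth.
Context {R : realType} {d : nat}.
Implicit Types f : 'rV[R]_d -> R.

Definition partial (i : 'I_d) f : 'rV[R]_d -> R :=
  fun x => 'D_(delta_mx 0 i) f x.

Definition smooth f := forall s : seq 'I_d,
  continuous (foldr partial f s) /\
  forall i x, derivable (foldr partial f s) x (delta_mx 0 i).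

Definition test_function (Omega : set 'rV[R]_d) f := smooth f /\
  exists K : set 'rV[R]_d,
    [/\ compact K, K `<=` Omega & forall x, ~ K x -> f x = 0].

End smooth.

Section square_integrable.
Context {disp : measure_display} {T : measurableType disp} {R : realType}.
Variables (mu : {measure set T -> \bar R}) (D : set T).

Definition L2 (f : T -> R) :=
  measurable_fun D f /\ (\int[mu]_(x in D) ((f x) ^+ 2)%:E < +oo)%E.

Definition sqdist (f g : T -> R) : \bar R :=
  (\int[mu]_(x in D) ((f x - g x) ^+ 2)%:E)%E.

End square_integrable.

(* A scalar Sobolev function is handled together with a representative of its
   weak gradient (unique up to null sets): u.1 is the function and u.2 i its
   i-th weak partial derivative. Jets, and families of d jets for vector
   fields, are lmodTypes with pointwise operations. *)
Notation jet R d :=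
  (('rV[R]_d -> R^o) * ('I_d -> 'rV[R]_d -> R^o))%type.
Notation vjet R d := ('I_d -> jet R d).

Section sobolev.
Context {R : realType} {d : nat}.
Variable Omega : set 'rV[R]_d.
Implicit Types (u q : jet R d) (v : vjet R d).

Definition weak_partial (i : 'I_d) (f g : 'rV[R]_d -> R) :=
  forall phi, test_function Omega phi ->
    \int[dx R d]_(x in Omega) (f x * partial i phi x) =
    - \int[dx R d]_(x in Omega) (g x * phi x).

Definition H1 : set (jet R d) := [set u |
  L2 (dx R d) Omega u.1 /\
  forall i, L2 (dx R d) Omega (u.2 i) /\ weak_partial i u.1 (u.2 i)].

Definition vH1 : set (vjet R d) := [set v | forall i, H1 (v i)].

Definition H1norm u : R := Num.sqrt
  (\int[dx R d]_(x in Omega) (u.1 x ^+ 2) +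
   \sum_(i < d) \int[dx R d]_(x in Omega) (u.2 i x ^+ 2)).

Definition vH1norm v : R := Num.sqrt (\sum_(i < d) H1norm (v i) ^+ 2).

(* t is the trace of u on the part S of the boundary: the L^2(S)-limit of the
   restrictions of smooth functions converging to u in H^1(Omega). *)
Definition is_trace (S : set 'rV[R]_d) u (t : 'rV[R]_d -> R) :=
  L2 (surf R d) S t /\
  exists phi : nat -> 'rV[R]_d -> R,
    [/\ forall k, smooth (phi k),
        sqdist (dx R d) Omega (phi k) u.1 @[k --> \oo] --> 0%E,
        forall i, sqdist (dx R d) Omega (partial i (phi k)) (u.2 i)
                    @[k --> \oo] --> 0%E &
        sqdist (surf R d) S (phi k) t @[k --> \oo] --> 0%E].

Definition trace (S : set 'rV[R]_d) u : 'rV[R]_d -> R :=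
  xget (cst 0) [set t | is_trace S u t].

Definition normal_trace (S : set 'rV[R]_d) v : 'rV[R]_d -> R :=
  fun x => \sum_(i < d) trace S (v i) x * outer_normal Omega x 0 i.

Definition H1_0 (S : set 'rV[R]_d) : set (jet R d) :=
  [set q | H1 q /\ is_trace S q (cst 0)].

Definition vH1_0 (S : set 'rV[R]_d) : set (vjet R d) :=
  [set v | forall i, H1_0 S (v i)].

Definition eq_H1 u q := u.1 = q.1 %[ae dx R d in Omega].

Definition eq_vH1 v w := forall i, eq_H1 (v i) (w i).

End sobolev.

Section half_space.
Context {R : realType} {d : nat}.
Variable S : set 'rV[R]_d.
Implicit Type g : 'rV[R]_d -> R.

(* Squared Sobolev-Slobodeckij norm of order 1/2 on the (d-1)-dimensional
   set S. *)
Definition sqHhalf g : \bar R :=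
  (\int[surf R d]_(x in S) ((g x) ^+ 2)%:E +
   \int[surf R d]_(x in S) \int[surf R d]_(y in S)
     ((g x - g y) ^+ 2 / enorm ((x : 'rV[R]_d) - y) ^+ d)%:E)%E.

Definition Hhalf : set ('rV[R]_d -> R) := [set g |
  measurable_fun (S : set (surfaceT R d)) g /\ (sqHhalf g < +oo)%E].

Definition Hhalf_norm g : R := Num.sqrt (fine (sqHhalf g)).

End half_space.

Section dual.
Context {R : realType} {E : lmodType R}.
Variables (W : set E) (N : E -> R).

Definition dual : set (E -> R) := [set f |
  (forall (r : R) u v, W u -> W v -> f (r *: u + v) = r * f u + f v) /\
  exists C : R, forall u, W u -> `|f u| <= C * N u].

Definition dual_norm (f : E -> R) : R :=
  sup [set `|f u| | u in [set u | W u /\ N u <= 1]].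

End dual.

Section poroelasticity.
Context {R : realType} {d : nat}.
Variables (Omega : set 'rV[R]_d) (tau iota alpha : R).
Variable kappa : 'rV[R]_d -> 'M[R]_d.
Implicit Types (u v : vjet R d) (p q : jet R d) (x : 'rV[R]_d).

Definition strain u (i j : 'I_d) x : R :=
  2^-1 * ((u i).2 j x + (u j).2 i x).

Definition divergence u x : R := \sum_(i < d) (u i).2 i x.

Definition form_a u v : R :=
  2 * tau * \int[dx R d]_(x in Omega)
      (\sum_(i < d) \sum_(j < d) strain u i j x * strain v i j x) +
  iota * \int[dx R d]_(x in Omega) (divergence u x * divergence v x).

Definition form_b u q : R :=
  alpha * \int[dx R d]_(x in Omega) (divergence u x * q.1 x).

Definition form_c p q : R :=
  alpha ^+ 2 / iota * \int[dx R d]_(x in Omega) (p.1 x * q.1 x) +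
  \int[dx R d]_(x in Omega)
    (\sum_(i < d) (\sum_(j < d) kappa x i j * p.2 j x) * q.2 i x).

Definition norm_u v : R := Num.sqrt (form_a v v).

Definition norm_p q : R := Num.sqrt (form_c q q).

(* Bounded measurable, symmetric, uniformly positive definite. *)
Definition admissible_kappa :=
  [/\ forall i j, measurable_fun (Omega : set (lebesgueT R d))
                    (fun x => kappa x i j),
      exists M : R, \forall x \ae dx R d, Omega x ->
        forall i j, `|kappa x i j| <= M,
      \forall x \ae dx R d, Omega x -> (kappa x)^T = kappa x &
      exists2 k0 : R, 0 < k0 & \forall x \ae dx R d, Omega x ->
        forall xi : 'rV[R]_d, k0 * enorm xi ^+ 2 <= dotp (xi *m kappa x) xi].

Variables Gamma_d Gamma_c Gamma_p : set 'rV[R]_d.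

Let U := vH1_0 Omega Gamma_d.
Let V := H1_0 Omega Gamma_p.
Let gamma := normal_trace Omega Gamma_c.

(* The nontrivial half of the equivalence of norm_u with the H^1 norm. *)
Definition korn_inequality := exists2 c : R, 0 < c &
  forall v, U v -> c * vH1norm Omega v <= norm_u v.

(* gamma is a bounded linear map of vH1_0 Omega Gamma_d onto
   H^{1/2}(Gamma_c). *)
Definition normal_trace_bounded_onto :=
  [/\ forall (r : R) u v, U u -> U v ->
        gamma (r *: u + v) = (fun x => r * gamma u x + gamma v x)
          %[ae surf R d in Gamma_c],
      forall v, U v -> Hhalf Gamma_c (gamma v),
      exists C : R, forall v, U v ->
        Hhalf_norm Gamma_c (gamma v) <= C * norm_u v &
      forall g, Hhalf Gamma_c g ->
        exists2 v, U v & gamma v = g %[ae surf R d in Gamma_c]].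

Definition normal_trace_norm (g : 'rV[R]_d -> R) : R :=
  inf [set norm_u w | w in
    [set w | U w /\ gamma w = g %[ae surf R d in Gamma_c]]].

Definition noncontact (g : 'rV[R]_d -> R) : set (vjet R d) := [set v |
  U v /\ \forall x \ae surf R d, Gamma_c x -> gamma v x <= g x].

Definition is_solution (fe : vjet R d -> R) (ff : jet R d -> R)
    (g : 'rV[R]_d -> R) u p :=
  [/\ noncontact g u, V p,
      forall v, noncontact g v ->
        fe (v - u) <= form_a u (v - u) - form_b (v - u) p &
      forall q, V q -> - form_b u q - form_c p q = ff q].

Definition admissible_data (fe : vjet R d -> R) (ff : jet R d -> R)
    (g : 'rV[R]_d -> R) :=
  [/\ dual U norm_u fe, dual V norm_p ff, Hhalf Gamma_c g &
      noncontact g !=set0].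

End poroelasticity.

(* Main.v *)
(** Eliminating the pressure turns the coupled problem into a symmetric
    variational inequality: if [P u] is the Riesz representative of [b u] for
    the form [c], then [b v (P u) = c (P u) (P v)], and [u] minimises a
    quadratic functional for [a u v + c (P u) (P v)] over the closed convex set
    [K g]. Testing the problem for the data [g] with [u' + w] and the one for
    [g'] with [u - w], where the normal trace of [w] is [g - g'], gives
    uniqueness and the Lipschitz estimate.

    Completeness of the energy spaces rests on the Riesz-Fischer theorem and on
    the Borel measurability of Caratheodory's sigma-algebras for the Lebesgue
    and Hausdorff outer measures; [K g] is closed by Chebyshev's inequality on
    the contact boundary. *)
Require Import Defs.
From mathcomp Require Import all_boot all_order all_algebra.
From mathcomp Require Import all_classical all_reals all_analysis.
From mathcomp Require Import measurable_realfun ring lra.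
Import Order.TTheory GRing.Theory Num.Theory.
Import numFieldNormedType.Exports.
Local Open Scope classical_set_scope.
Local Open Scope ring_scope.
Set Implicit Arguments.
Unset Strict Implicit.
Unset Printing Implicit Defensive.

(** * Quadratic minimisation *)

(** Jets are functions, not classes modulo null sets, so an energy may vanish on a nonzero jet, and
    integrals are additive only where the integrands are integrable. Hilbert space arguments are
    therefore carried out for positive semidefinite forms on a subspace of an [lmodType], with
    convergence expressed by the form itself. Uniqueness first appears as a difference of zero
    energy and becomes equality almost everywhere only at the end.

    The normal trace is built from chosen representatives and is linear only almost everywhere, so
    each pointwise use of the constraint collects countably many null sets.

    The weights $\iota$ in $a$ and $\alpha^2/\iota$ in $c$ multiply to $\alpha^2$; this gives $b$
    the bound $1$ in the two energy norms and keeps the material parameters out of the estimate. The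
    factor $3$ counts the terms containing the lifting $w$: one from the load tested with $u-u'-w$,
    one from $a$ and one from $b$. *)

Section quadratic.
Context {R : realType} {E : lmodType R}.
Implicit Types (W K : set E) (s : E -> E -> R) (l : E -> R).

Definition is_subspace W := W 0 /\ forall (r : R) u v, W u -> W v -> W (r *: u + v).

Definition linear_on W l :=
  forall (r : R) u v, W u -> W v -> l (r *: u + v) = r * l u + l v.

(** Only semidefinite, and only on [W]: forms given by integrals are bilinear where the integrands
    are integrable, and a jet supported on a null set has zero energy. *)
Definition semi_inner W s :=
  [/\ forall w, W w -> linear_on W (s^~ w),
      forall u v, W u -> W v -> s u v = s v u &
      forall u, W u -> 0 <= s u u].

(** Sequential completeness for the squared seminorm. The limit is merely some point of [K], since
    points at distance zero are not identified. *)
Definition complete_for s K := forall x : nat -> E, (forall n, K (x n)) ->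
  (forall e, 0 < e -> exists N, forall m n, (N <= m)%N -> (N <= n)%N ->
     s (x m - x n) (x m - x n) < e) ->
  exists2 y, K y & forall e, 0 < e -> exists N, forall n, (N <= n)%N ->
     s (x n - y) (x n - y) < e.

Section subspace_theory.
Variable W : set E.
Hypothesis subW : is_subspace W.

Lemma subspaceD u v : W u -> W v -> W (u + v).
Proof. by move=> Wu Wv; rewrite -[u]scale1r; apply: subW.2. Qed.

Lemma subspaceZ r u : W u -> W (r *: u).
Proof. by move=> Wu; rewrite -[_ *: _]addr0; apply: subW.2 => //; exact: subW.1. Qed.

Lemma subspaceN u : W u -> W (- u).
Proof. by move=> Wu; rewrite -scaleN1r; exact: subspaceZ. Qed.

Lemma subspaceB u v : W u -> W v -> W (u - v).
Proof. by move=> Wu Wv; apply: subspaceD => //; exact: subspaceN. Qed.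

Section linear_on_theory.
Variable l : E -> R.
Hypothesis linl : linear_on W l.

Lemma linear_on0 : l 0 = 0.
Proof.
have := linl 1 subW.1 subW.1; rewrite scale1r add0r mul1r => h.
by apply: (addrI (l 0)); rewrite -h addr0.
Qed.

Lemma linear_onD u v : W u -> W v -> l (u + v) = l u + l v.
Proof. by move=> Wu Wv; rewrite -[u in LHS]scale1r linl// mul1r. Qed.

Lemma linear_onZ r u : W u -> l (r *: u) = r * l u.
Proof.
by move=> Wu; rewrite -[_ *: _]addr0 linl ?linear_on0 ?addr0//; exact: subW.1.
Qed.

Lemma linear_onN u : W u -> l (- u) = - l u.
Proof. by move=> Wu; rewrite -scaleN1r linear_onZ// mulN1r. Qed.

Lemma linear_onB u v : W u -> W v -> l (u - v) = l u - l v.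
Proof.
by move=> Wu Wv; rewrite linear_onD ?linear_onN//; exact: subspaceN.
Qed.

Lemma subspace_sum (I : Type) (r : seq I) (f : I -> E) :
  (forall i, W (f i)) -> W (\sum_(i <- r) f i).
Proof. by move=> Wf; elim/big_ind: _ => //; [exact: subW.1|exact: subspaceD]. Qed.

Lemma linear_on_sum (I : Type) (r : seq I) (f : I -> E) :
  (forall i, W (f i)) -> l (\sum_(i <- r) f i) = \sum_(i <- r) l (f i).
Proof.
move=> Wf; elim: r => [|i r IH]; first by rewrite !big_nil linear_on0.
by rewrite !big_cons linear_onD ?IH//; exact: subspace_sum.
Qed.

End linear_on_theory.

Section semi_inner_theory.
Variable s : E -> E -> R.
Hypothesis ss : semi_inner W s.

Lemma semi_innerC u v : W u -> W v -> s u v = s v u.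
Proof. by case: ss => _ + _; exact. Qed.

Lemma semi_inner_ge0 u : W u -> 0 <= s u u.
Proof. by case: ss => _ _; exact. Qed.

Lemma semi_inner_linl w : W w -> linear_on W (s^~ w).
Proof. by case: ss => + _ _; exact. Qed.

Lemma semi_inner_linr w : W w -> linear_on W (s w).
Proof.
move=> Ww r u v Wu Wv; have Wruv := subW.2 r u v Wu Wv.
by rewrite (semi_innerC Ww Wruv) semi_inner_linl// (semi_innerC Wu Ww) (semi_innerC Wv Ww).
Qed.

Lemma semi_inner_sqrD (t : R) u v : W u -> W v ->
  s (u + t *: v) (u + t *: v) = s u u + 2 * t * s u v + t ^+ 2 * s v v.
Proof.
move=> Wu Wv; have Wtv := subspaceZ t Wv; have Wutv := subspaceD Wu Wtv.
rewrite (linear_onD (semi_inner_linl Wutv))//.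
rewrite (linear_onD (semi_inner_linr Wu))// (linear_onD (semi_inner_linr Wtv))//.
rewrite !(linear_onZ (semi_inner_linr _))// !(linear_onZ (semi_inner_linl _))//.
by rewrite (semi_innerC Wv Wu); ring.
Qed.

Lemma semi_inner_sqrB u v : W u -> W v ->
  s (u - v) (u - v) = s u u - 2 * s u v + s v v.
Proof. by move=> Wu Wv; rewrite -scaleN1r semi_inner_sqrD//; ring. Qed.

Lemma semi_inner_le_mean u v : W u -> W v -> s u v <= 2^-1 * (s u u + s v v).
Proof.
move=> Wu Wv; have := semi_inner_ge0 (subspaceB Wu Wv).
by rewrite semi_inner_sqrB//; lra.
Qed.

Lemma semi_inner_sum_le (I : finType) (f : I -> E) (M : R) :
  (forall i, W (f i)) -> (forall i, s (f i) (f i) <= M) ->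
  s (\sum_i f i) (\sum_i f i) <= #|I|%:R ^+ 2 * M.
Proof.
move=> Wf fM; have Wsum : W (\sum_i f i) by exact: subspace_sum.
rewrite (linear_on_sum (semi_inner_linl Wsum))//.
apply: (@le_trans _ _ (\sum_(i : I) \sum_(j : I) M)).
  apply: ler_sum => i _; rewrite (linear_on_sum (semi_inner_linr (Wf i)))//.
  apply: ler_sum => j _; apply: le_trans (semi_inner_le_mean (Wf i) (Wf j)) _.
  by have := fM i; have := fM j; lra.
by rewrite !sumr_const -mulrnA -[leLHS]mulr_natl natrM expr2.
Qed.

Lemma semi_inner_cauchy_schwarz u v : W u -> W v ->
  s u v ^+ 2 <= s u u * s v v.
Proof.
move=> Wu Wv; have h t : 0 <= s u u + 2 * t * s u v + t ^+ 2 * s v v.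
  by rewrite -semi_inner_sqrD//; apply/semi_inner_ge0/subspaceD/subspaceZ.
have [vv0|vvn0] := eqVneq (s v v) 0.
  have [uv0|uvn0] := eqVneq (s u v) 0; first by rewrite uv0 vv0 expr0n mulr0.
  (* With [s v v = 0] the quadratic in [t] is affine; this [t] gives it the value $-1$, which
     contradicts positivity. *)
  have := h (- (s u u + 1) / (2 * s u v)); rewrite vv0 mulr0 addr0.
  have -> : s u u + 2 * (- (s u u + 1) / (2 * s u v)) * s u v = -1 by field.
  by rewrite ler0N1.
have vv_gt0 : 0 < s v v by rewrite lt_neqAle eq_sym vvn0 semi_inner_ge0.
(* The minimiser of the quadratic in [t]. *)
have := h (- s u v / s v v).
have -> : s u u + 2 * (- s u v / s v v) * s u v + (- s u v / s v v) ^+ 2 * s v v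
    = s u u - s u v ^+ 2 / s v v by field.
by rewrite subr_ge0 ler_pdivrMr.
Qed.

Lemma semi_inner_le u v : W u -> W v ->
  `|s u v| <= Num.sqrt (s u u) * Num.sqrt (s v v).
Proof.
move=> Wu Wv; rewrite -sqrtrM ?semi_inner_ge0// -sqrtr_sqr.
by rewrite ler_wsqrtr// semi_inner_cauchy_schwarz.
Qed.

(* Riesz representation on convex sets: the solution minimises
   [s x x - 2 * l x], and minimising sequences are Cauchy by the parallelogram
   identity. *)
Lemma variational_inequality K l (C : R) : K `<=` W -> K !=set0 ->
  (forall x y (t : R), K x -> K y -> 0 <= t <= 1 -> K (x + t *: (y - x))) ->
  complete_for s K -> linear_on W l ->
  (forall u, W u -> `|l u| <= C * Num.sqrt (s u u)) ->
  exists2 u, K u & forall v, K v -> l (v - u) <= s u (v - u).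
Proof.
move=> KW [x0 Kx0] cvxK compK linl lC.
pose J x := s x x - 2 * l x.
(* With $q=\sqrt{s(x,x)}$, $J(x)\ge q^2-2Cq=(q-C)^2-C^2$. *)
have JC x : W x -> - C ^+ 2 <= J x.
  move=> Wx; have := lC _ Wx; rewrite ler_norml => /andP[_ lx].
  have := sqr_sqrtr (semi_inner_ge0 Wx); rewrite /J.
  set q := Num.sqrt _ in lx * => <-.
  have := sqr_ge0 (q - C); nra.
pose m := inf (J @` K).
have hinf : has_inf (J @` K).
  split; first by exists (J x0), x0.
  by exists (- C ^+ 2) => _ [x Kx <-]; apply/JC/KW.
have mJ x : K x -> m <= J x by move=> Kx; apply: ge_inf; [exact: hinf.2|exists x].
have /choice[x xP] : forall n, exists x, K x /\ J x < m + n.+1%:R^-1.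
  move=> n; have [|_ [x Kx <-] Jx] := @inf_adherent _ _ n.+1%:R^-1 _ hinf.
    by rewrite invr_gt0.
  by exists x.
have Kx n : K (x n) by have [] := xP n.
have Jx n : J (x n) < m + n.+1%:R^-1 by have [] := xP n.
(* The midpoint of [u] and [v] lies in [K], so its value of [J] is at least [m]; the linear part of
   [J] cancels in the parallelogram identity. *)
have par u v : K u -> K v -> s (u - v) (u - v) <= 2 * (J u - m) + 2 * (J v - m).
  move=> Ku Kv; have Wu := KW _ Ku; have Wv := KW _ Kv.
  have half01 : 0 <= (2^-1 : R) <= 1 by apply/andP; split; lra.
  have := mJ _ (cvxK u v 2^-1 Ku Kv half01); rewrite /J; have WB := subspaceB Wv Wu.
  rewrite semi_inner_sqrD// (linear_onD linl)//; last exact: subspaceZ.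
  rewrite (linear_onZ linl)// (linear_onB linl)// (linear_onB (semi_inner_linr Wu))//.
  rewrite !semi_inner_sqrB// (semi_innerC Wv Wu) (_ : 2^-1 ^+ 2 = 4^-1 :> R); [lra|by field].
have small (e : R) : 0 < e -> exists N, forall n, (N <= n)%N -> n.+1%:R^-1 < e.
  move=> e0; have [N _ hN] := near_infty_natSinv_lt (PosNum e0).
  by exists N => n Nn; exact: hN.
have [|y Ky xy] := compK x Kx.
  move=> e e0; have [|N hN] := small (e / 4); first by rewrite divr_gt0.
  exists N => p n Np Nn; apply: le_lt_trans (par _ _ (Kx p) (Kx n)) _.
  have := hN _ Np; have := hN _ Nn; have := Jx p; have := Jx n.
  by move: p.+1%:R^-1 n.+1%:R^-1 => ep en; lra.
have Wy := KW _ Ky; have Jy : J y <= m.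
  apply/ler_addgt0Pl => e e0.
  (* For $h=x_n-y$, [M] bounds the first-order change $2s(y,h)-2l(h)$ of [J] relative to the
     seminorm of [h]; the added $1$ keeps it positive. *)
  pose M := 2 * (Num.sqrt (s y y) + `|C|) + 1.
  have M0 : 0 < M by rewrite ltr_wpDl// mulr_ge0// addr_ge0// sqrtr_ge0.
  have [|N1 hN1] := xy ((e / 2 / M) ^+ 2).
    by rewrite exprn_gt0// !divr_gt0.
  have [|N2 hN2] := small (e / 2); first by rewrite divr_gt0.
  pose n := maxn N1 N2.
  have {hN1} := hN1 n (leq_maxl _ _); have {hN2} := hN2 n (leq_maxr _ _) => n2 n1.
  have Wh : W (x n - y) by apply/subspaceB/Wy/KW.
  have hM : Num.sqrt (s (x n - y) (x n - y)) <= e / 2 / M.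
    rewrite -[leRHS]ger0_norm; last by rewrite !divr_ge0 ?ltW.
    by rewrite -sqrtr_sqr ler_wsqrtr// ltW.
  have := Jx n; have -> : x n = y + 1 *: (x n - y) by rewrite scale1r addrC subrK.
  move: (x n - y) Wh hM => h Wh hM.
  rewrite /J semi_inner_sqrD// scale1r (linear_onD linl)// expr1n !mul1r mulr1.
  have sh0 := semi_inner_ge0 Wh; have := semi_inner_le Wy Wh; have := lC _ Wh.
  rewrite !ler_norml => /andP[_ lh] /andP[syh _].
  set q := Num.sqrt (s h h) in lh syh hM *.
  have q0 : 0 <= q by exact: sqrtr_ge0.
  have : M * q <= e / 2 by rewrite mulrC -ler_pdivlMr.
  have : C * q <= `|C| * q by rewrite ler_wpM2r// ler_norm.
  rewrite /M; move: n.+1%:R^-1 n2 => en n2. nra.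
exists y => // v Kv; have Wv := KW _ Kv; have Ww := subspaceB Wv Wy.
apply/ler_addgt0Pl => e e0; have svy := semi_inner_ge0 Ww.
(* A step from [y] towards [v] that stays in [K] and is so short that the second-order term, after
   division by [t], is at most [e]. *)
pose t := Num.min 1 (e / (s (v - y) (v - y) + 1)).
have D0 : 0 < s (v - y) (v - y) + 1 by rewrite ltr_wpDl.
have t0 : 0 < t by rewrite lt_min ltr01 divr_gt0.
have t1 : t <= 1 by rewrite ge_min lexx.
have te : t * s (v - y) (v - y) <= e.
  rewrite (@le_trans _ _ (t * (s (v - y) (v - y) + 1)))//.
    by rewrite ler_pM2l// ler_wpDr.
  by rewrite -ler_pdivlMr// ge_min lexx orbT.
have := le_trans Jy (mJ _ (cvxK y v t Ky Kv _)); rewrite t1 ltW//.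
move=> /(_ isT); rewrite /J semi_inner_sqrD// (linear_onD linl)//; last exact: subspaceZ.
rewrite (linear_onZ linl)//.
move: te; set a := s (v - y) (v - y); set b := s y (v - y); set c := l (v - y).
move=> te h; suff : 0 <= 2 * (b - c) + t * a by lra.
by rewrite -(pmulr_rge0 _ t0); lra.
Qed.

(** On a subspace both [u + v] and [u - v] are admissible, so the variational inequality becomes an
    equality. *)
Lemma riesz_representation l (C : R) : complete_for s W -> linear_on W l ->
  (forall u, W u -> `|l u| <= C * Num.sqrt (s u u)) ->
  exists2 u, W u & forall v, W v -> s u v = l v.
Proof.
move=> compW linl lC.
have [| | |u Wu uP] := @variational_inequality W l C _ _ _ compW linl lC; first by [].
- by exists 0; exact: subW.1.
- by move=> x y t Wx Wy _; apply/subspaceD/subspaceZ/subspaceB.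
exists u => // v Wv; apply/eqP; rewrite eq_le.
have := uP _ (subspaceD Wu Wv); rewrite addrAC subrr add0r => ->; rewrite andbT.
have := uP _ (subspaceB Wu Wv); rewrite addrAC subrr add0r.
by rewrite (linear_onN linl)// (linear_onN (semi_inner_linr Wu))// lerN2.
Qed.

Let dual_norm_has_ubound l : dual W (fun u => Num.sqrt (s u u)) l ->
  has_ubound [set `|l u| | u in [set u | W u /\ Num.sqrt (s u u) <= 1]].
Proof.
move=> [_ [C lC]]; exists `|C| => _ [u [Wu u1] <-]; apply: le_trans (lC _ Wu) _.
apply: le_trans (ler_norm _) _; rewrite normrM ler_piMr//.
by rewrite ger0_norm// sqrtr_ge0.
Qed.

Lemma dual_norm_ge0 l : dual W (fun u => Num.sqrt (s u u)) l ->
  0 <= dual_norm W (fun u => Num.sqrt (s u u)) l.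
Proof.
move=> dl; apply: ub_le_sup; first exact: dual_norm_has_ubound.
exists 0; last by have [linl _] := dl; rewrite (linear_on0 linl) normr0.
split; first exact: subW.1.
by rewrite (linear_on0 (semi_inner_linl subW.1)) sqrtr0.
Qed.

Lemma dual_norm_le l v : dual W (fun u => Num.sqrt (s u u)) l -> W v ->
  `|l v| <= dual_norm W (fun u => Num.sqrt (s u u)) l * Num.sqrt (s v v).
Proof.
move=> dl Wv; have [linl [C lC]] := dl; set q := Num.sqrt (s v v).
(* A vector of zero seminorm cannot be normalised, but the bound in [dual] forces [l] to vanish on
   it. *)
have [q0|qn0] := eqVneq q 0.
  by rewrite q0 mulr0; have := lC _ Wv; rewrite -/q q0 mulr0.
have q_gt0 : 0 < q by rewrite lt_neqAle eq_sym qn0 sqrtr_ge0.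
rewrite -ler_pdivrMr//; apply: ub_le_sup; first exact: dual_norm_has_ubound.
exists (q^-1 *: v); last first.
  by rewrite (linear_onZ linl)// normrM gtr0_norm ?invr_gt0// mulrC.
split; first exact: subspaceZ.
have Wqv : W (q^-1 *: v) by exact: subspaceZ.
rewrite (linear_onZ (semi_inner_linr _))// (linear_onZ (semi_inner_linl _))//.
rewrite -(sqr_sqrtr (semi_inner_ge0 Wv)) -/q.
have -> : q^-1 * (q^-1 * q ^+ 2) = 1 by field.
by rewrite sqrtr1.
Qed.

Lemma dualB l l' : dual W (fun u => Num.sqrt (s u u)) l ->
  dual W (fun u => Num.sqrt (s u u)) l' ->
  dual W (fun u => Num.sqrt (s u u)) (fun u => l u - l' u).
Proof.
move=> [linl [C lC]] [linl' [C' lC']]; split.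
  by move=> r u v Wu Wv; rewrite linl// linl'//; ring.
exists (C + C') => u Wu; rewrite mulrDl; apply: le_trans (ler_normB _ _) _.
by apply: lerD; [exact: lC|exact: lC'].
Qed.

End semi_inner_theory.
End subspace_theory.
End quadratic.

(** * Saddle points *)

Section semi_inner_constructions.
Context {R : realType} {E E' : lmodType R}.
Variables (W : set E) (W' : set E').

Lemma eq_semi_inner (s s' : E -> E -> R) : is_subspace W ->
  (forall u v, W u -> W v -> s u v = s' u v) -> semi_inner W s' -> semi_inner W s.
Proof.
move=> subW ss' [lin sym ge0]; split=> [w Ww r u v Wu Wv|u v Wu Wv|u Wu].
- by rewrite !ss'//; [exact: lin|exact: subW.2].
- by rewrite !ss'//; exact: sym.
- by rewrite ss'//; exact: ge0.
Qed.

Lemma semi_innerD (s s' : E -> E -> R) :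
  semi_inner W s -> semi_inner W s' -> semi_inner W (fun u v => s u v + s' u v).
Proof.
move=> [l1 c1 p1] [l2 c2 p2]; split=> [w Ww r u v Wu Wv|u v Wu Wv|u Wu].
- by rewrite l1// l2//; ring.
- by rewrite c1// c2.
- by rewrite addr_ge0 ?p1 ?p2.
Qed.

Lemma semi_innerZ (k : R) (s : E -> E -> R) : 0 <= k ->
  semi_inner W s -> semi_inner W (fun u v => k * s u v).
Proof.
move=> k0 [l1 c1 p1]; split=> [w Ww r u v Wu Wv|u v Wu Wv|u Wu].
- by rewrite l1//; ring.
- by rewrite c1.
- by rewrite mulr_ge0// p1.
Qed.

Lemma semi_inner_sum (I : finType) (s : I -> E -> E -> R) :
  (forall i, semi_inner W (s i)) -> semi_inner W (fun u v => \sum_i s i u v).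
Proof.
move=> si; split=> [w Ww r u v Wu Wv|u v Wu Wv|u Wu].
- rewrite mulr_sumr -big_split; apply: eq_bigr => i _ /=.
  by have [l1 _ _] := si i; rewrite l1.
- by apply: eq_bigr => i _; have [_ c1 _] := si i; rewrite c1.
- by apply: sumr_ge0 => i _; have [_ _ p1] := si i; rewrite p1.
Qed.

Lemma semi_inner_comp (s : E' -> E' -> R) (f : E -> E') :
  (forall u, W u -> W' (f u)) ->
  (forall (r : R) u v, f (r *: u + v) = r *: f u + f v) ->
  semi_inner W' s -> semi_inner W (fun u v => s (f u) (f v)).
Proof.
move=> fW flin [l1 c1 p1]; split=> [w Ww r u v Wu Wv|u v Wu Wv|u Wu].
- by rewrite flin l1//; exact: fW.
- by rewrite c1//; exact: fW.
- by rewrite p1//; exact: fW.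
Qed.

(** The lower bound makes sequences that are Cauchy for [s'] Cauchy for [s]; the upper bound carries
    the limit back. *)
Lemma complete_for_equiv (s s' : E -> E -> R) (c C : R) (K : set E) :
  is_subspace W -> K `<=` W -> 0 < c -> 0 < C ->
  (forall u, W u -> c * s u u <= s' u u) -> (forall u, W u -> s' u u <= C * s u u) ->
  complete_for s K -> complete_for s' K.
Proof.
move=> subW KW c0 C0 cs sC compK x Kx cauchyx; have WB := subspaceB subW.
have [|y Ky xy] := compK x Kx.
  move=> e e0; have [|N HN] := cauchyx (c * e); first exact: mulr_gt0.
  exists N => m n Nm Nn; rewrite -(ltr_pM2l c0).
  apply: le_lt_trans (cs _ _) (HN m n Nm Nn).
  exact: (WB _ _ (KW _ (Kx m)) (KW _ (Kx n))).
exists y => // e e0; have [|N HN] := xy (e / C); first exact: divr_gt0.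
exists N => n Nn; apply: le_lt_trans (sC _ _) _.
  exact: (WB _ _ (KW _ (Kx n)) (KW _ Ky)).
by rewrite mulrC -ltr_pdivlMr//; exact: HN.
Qed.

End semi_inner_constructions.

Section saddle_point.
Context {R : realType} {E F : lmodType R}.
Variables (U : set E) (V : set F) (a : E -> E -> R) (b : E -> F -> R) (c : F -> F -> R).
Hypotheses (subU : is_subspace U) (subV : is_subspace V).
Hypotheses (aP : semi_inner U a) (cP : semi_inner V c).
Hypotheses (blinl : forall q, V q -> linear_on U (b^~ q))
           (blinr : forall u, U u -> linear_on V (b u)).
Hypothesis b_le : forall u q, U u -> V q ->
  `|b u q| <= Num.sqrt (a u u) * Num.sqrt (c q q).

Definition saddle_point (K : set E) (fe : E -> R) (ff : F -> R) u p :=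
  [/\ K u, V p, forall v, K v -> fe (v - u) <= a u (v - u) - b (v - u) p &
      forall q, V q -> - b u q - c p q = ff q].

(* Eliminating [p] leaves a symmetric variational inequality: if [P u] is the
   Riesz representative of [b u] for [c], then [b v (P u) = c (P u) (P v)]. *)
Lemma saddle_point_exists K fe ff (Ce Cf : R) :
  complete_for c V -> complete_for a K -> K `<=` U -> K !=set0 ->
  (forall x y (t : R), K x -> K y -> 0 <= t <= 1 -> K (x + t *: (y - x))) ->
  linear_on U fe -> (forall u, U u -> `|fe u| <= Ce * Num.sqrt (a u u)) ->
  linear_on V ff -> (forall q, V q -> `|ff q| <= Cf * Num.sqrt (c q q)) ->
  exists u p, saddle_point K fe ff u p.
Proof.
move=> compV compK KU K0 cvxK linfe feC linff ffC.
(* Outside [U] the value of [P] is irrelevant and set to [0]. *)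
have /choice[P PP] u : exists p, U u -> V p /\ forall q, V q -> c p q = b u q.
  have [Uu|nUu] := pselect (U u); last by exists 0.
  have [p Vp cp] := riesz_representation subV cP compV (blinr Uu) (fun q => b_le Uu).
  by exists p.
have PV u : U u -> V (P u) by move=> /PP[].
have cPb u q : U u -> V q -> c (P u) q = b u q by move=> /PP[_]; exact.
have [P0 VP0 cP0] := riesz_representation subV cP compV linff ffC.
pose s u v := a u v + c (P u) (P v).
(* Testing the equation of [P u] with [P u] gives $\|Pu\|_c^2=b(u,Pu)\le\|u\|_a\|Pu\|_c$. Hence [s]
   is equivalent to [a] with constants $1$ and $2$. *)
have cPa u : U u -> c (P u) (P u) <= a u u.
  move=> Uu; have VPu := PV _ Uu.
  have := b_le Uu VPu; rewrite -(cPb _ _ Uu VPu) ger0_norm ?(semi_inner_ge0 cP)//.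
  have := sqr_sqrtr (semi_inner_ge0 aP Uu).
  have := sqr_sqrtr (semi_inner_ge0 cP VPu).
  set x := Num.sqrt (a u u); set y := Num.sqrt _ => <- <- h.
  have [x0 y0] : 0 <= x /\ 0 <= y by split; exact: sqrtr_ge0.
  rewrite lerXn2r// ?nnegrE//; have [->//|yn0] := eqVneq y 0.
  by rewrite -(@ler_pM2r _ y) -?expr2// lt_neqAle eq_sym yn0.
have sP : semi_inner U s.
  split=> [w Uw r u v Uu Uv|u v Uu Uv|u Uu].
  - have Uruv : U (r *: u + v) by exact: subU.2.
    (* [P] comes from a choice; linearity of [s] is read off from $c(Pu,Pw)=b(u,Pw)$. *)
    have VPw := PV _ Uw; rewrite /s !cPb// (blinl VPw)//.
    by rewrite (semi_inner_linl aP Uw)//; ring.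
  - by rewrite /s (semi_innerC aP Uu Uv) (semi_innerC cP (PV _ Uu) (PV _ Uv)).
  - by rewrite /s addr_ge0 ?(semi_inner_ge0 aP)// (semi_inner_ge0 cP (PV _ Uu)).
have a_le_s u : U u -> a u u <= s u u.
  by move=> Uu; rewrite /s lerDl (semi_inner_ge0 cP (PV _ Uu)).
have compKs : complete_for s K.
  apply: (@complete_for_equiv _ _ U a s 1 2) => // u Uu; first by rewrite mul1r a_le_s.
  by rewrite /s mulr2n mulrDl !mul1r lerD2l cPa.
pose l w := fe w - b w P0.
have linl : linear_on U l.
  by move=> r u v Uu Uv; rewrite /l linfe// (blinl VP0)//; ring.
have lC u : U u -> `|l u| <= (`|Ce| + Num.sqrt (c P0 P0)) * Num.sqrt (s u u).
  move=> Uu; have as_ : Num.sqrt (a u u) <= Num.sqrt (s u u) by rewrite ler_wsqrtr ?a_le_s.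
  apply: le_trans (ler_normB _ _) _; rewrite mulrDl; apply: lerD.
    apply: le_trans (feC _ Uu) _; apply: (@le_trans _ _ (`|Ce| * Num.sqrt (a u u))).
      by rewrite ler_wpM2r ?sqrtr_ge0// ler_norm.
    by rewrite ler_wpM2l.
  apply: le_trans (b_le Uu VP0) _.
  by rewrite mulrC ler_wpM2l// sqrtr_ge0.
have [u Ku uP] := variational_inequality subU sP KU K0 cvxK compKs linl lC.
have Uu := KU _ Ku; have VPu := PV _ Uu; have VS := subspaceD subV VPu VP0.
(* The second equation says that $c(p,\cdot)=-b(u,\cdot)-f_f$, and [P0] represents [ff]. *)
exists u, (- (P u + P0)); split => //; first exact: subspaceN.
- move=> v Kv; have := uP v Kv; have Uw := subspaceB subU (KU _ Kv) Uu.
  rewrite /s /l (linear_onN subV (blinr Uw))// (linear_onD (blinr Uw))//.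
  by rewrite (semi_innerC cP VPu (PV _ Uw)) cPb//; lra.
- move=> q Vq; rewrite (linear_onN subV (semi_inner_linl cP Vq))//.
  by rewrite (linear_onD (semi_inner_linl cP Vq))// cPb// cP0//; ring.
Qed.

(* The test functions [u' + w] and [u - w] are admissible for the respective
   problems, so adding the two inequalities eliminates the constraint sets. *)
Lemma saddle_point_stable K K' fe fe' ff ff' u u' p p' w (Ne Nf : R) :
  U u -> U u' -> U w -> K (u' + w) -> K' (u - w) -> 0 <= Ne -> 0 <= Nf ->
  linear_on U fe -> linear_on U fe' -> linear_on V ff -> linear_on V ff' ->
  (forall v, U v -> `|fe v - fe' v| <= Ne * Num.sqrt (a v v)) ->
  (forall q, V q -> `|ff q - ff' q| <= Nf * Num.sqrt (c q q)) ->
  saddle_point K fe ff u p -> saddle_point K' fe' ff' u' p' ->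
  Num.sqrt (Num.sqrt (a (u - u') (u - u')) ^+ 2 + Num.sqrt (c (p - p') (p - p')) ^+ 2)
  <= Ne + Nf + 3 * Num.sqrt (a w w).
Proof.
move=> Uu Uu' Uw Kw K'w Ne0 Nf0 lfe lfe' lff lff' feN ffN.
move=> [Ku Vp up pp] [Ku' Vp' up' pp'].
have Ue := subspaceB subU Uu Uu'; have Vr := subspaceB subV Vp Vp'.
have Uz := subspaceB subU Ue Uw.
have := up _ Kw; have := up' _ K'w.
have -> : u' + w - u = - (u - u' - w) by rewrite !opprB addrCA addrA.
have -> : u - w - u' = u - u' - w by rewrite addrAC.
rewrite (linear_onN subU lfe)// (linear_onN subU (semi_inner_linr subU aP Uu))//.
rewrite (linear_onN subU (blinl Vp))//.
have := pp _ Vr; have := pp' _ Vr.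
have := feN _ Uz; have := ffN _ Vr.
have aB : a (u - u') (u - u' - w) = a u (u - u' - w) - a u' (u - u' - w).
  by rewrite (linear_onB subU (semi_inner_linl aP Uz)).
have bB : b (u - u') (p - p') = b u (p - p') - b u' (p - p').
  by rewrite (linear_onB subU (blinl Vr)).
have bB' : b (u - u' - w) (p - p') = b (u - u' - w) p - b (u - u' - w) p'.
  by rewrite (linear_onB subV (blinr Uz)).
have bB'' : b (u - u' - w) (p - p') = b (u - u') (p - p') - b w (p - p').
  by rewrite (linear_onB subU (blinl Vr)).
have cB : c (p - p') (p - p') = c p (p - p') - c p' (p - p').
  by rewrite (linear_onB subV (semi_inner_linl cP Vr)).
have aB' : a (u - u') (u - u' - w) = a (u - u') (u - u') - a (u - u') w.
  by rewrite (linear_onB subU (semi_inner_linr subU aP Ue)).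
have az : Num.sqrt (a (u - u' - w) (u - u' - w)) <=
    Num.sqrt (a (u - u') (u - u')) + Num.sqrt (a w w).
  rewrite -(ger0_norm (addr_ge0 (sqrtr_ge0 _) (sqrtr_ge0 _))) -sqrtr_sqr ler_wsqrtr//.
  rewrite (semi_inner_sqrB subU aP Ue Uw) sqrrD !sqr_sqrtr ?(semi_inner_ge0 aP)//.
  have := semi_inner_le subU aP Ue Uw; rewrite ler_norml => /andP[+ _].
  rewrite mulr2n; lra.
move: az; have := b_le Uw Vr; have := semi_inner_le subU aP Ue Uw.
have := sqr_sqrtr (semi_inner_ge0 aP Ue); have := sqr_sqrtr (semi_inner_ge0 cP Vr).
set x := Num.sqrt (a (u - u') _); set y := Num.sqrt (c _ _); set t := Num.sqrt (a w w).
set z := Num.sqrt _ => y2 x2.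
rewrite !ler_norml => /andP[_ exw] /andP[bwr _] zxt /andP[ffr _] /andP[_ fez] p'r pr up2 up1.
have [x0 y0 t0 z0] : [/\ 0 <= x, 0 <= y, 0 <= t & 0 <= z].
  by split; exact: sqrtr_ge0.
(* With $e=u-u'$, $r=p-p'$ and $z=e-w$, the sum of the two inequalities reads
   $a(e,z)-b(z,r)\le(f_e-f_e')(z)$. The equation tested with $r$ replaces $b(e,r)$ by
   $-c(r,r)-(f_f-f_f')(r)$, which leaves
   $a(e,e)+c(r,r)\le(f_e-f_e')(z)+a(e,w)-b(w,r)-(f_f-f_f')(r)$. *)
have main : x ^+ 2 + y ^+ 2 <= Ne * (x + t) + x * t + t * y + Nf * y.
  have : Ne * z <= Ne * (x + t) by rewrite ler_wpM2l.
  rewrite x2 y2; lra.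
set X := Num.sqrt (x ^+ 2 + y ^+ 2).
have X2 : X ^+ 2 = x ^+ 2 + y ^+ 2 by rewrite sqr_sqrtr// addr_ge0 ?sqr_ge0.
have X0 : 0 <= X by exact: sqrtr_ge0.
have xX : x <= X by rewrite -(ger0_norm x0) -sqrtr_sqr ler_wsqrtr// lerDl sqr_ge0.
have yX : y <= X by rewrite -(ger0_norm y0) -sqrtr_sqr ler_wsqrtr// lerDr sqr_ge0.
(* If the bound failed, [Ne] would be at most [X], so the product [Ne * t] would also be at most
   [X * t]. The terms [Ne * t], [x * t] and [t * y] make up [3 * t * X]. *)
rewrite leNgt; apply/negP => big.
have : X * (Ne + Nf + 3 * t) < X ^+ 2.
  rewrite expr2 ltr_pM2l//; apply: le_lt_trans big.
  by rewrite !addr_ge0// mulr_ge0.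
rewrite X2; have NeX : Ne <= X by apply: ltW; apply: le_lt_trans big; lra.
have : Ne * x <= Ne * X by rewrite ler_wpM2l.
have : Nf * y <= Nf * X by rewrite ler_wpM2l.
have : x * t <= X * t by rewrite ler_wpM2r.
have : t * y <= t * X by rewrite ler_wpM2l.
have : Ne * t <= X * t by rewrite ler_wpM2r.
lra.
Qed.

End saddle_point.

(** * Square-integrable functions *)

Lemma cvge0_lt (R : realType) (u : (\bar R)^nat) : (u @ \oo --> 0)%E ->
  forall e : R, 0 < e -> exists N, forall n, (N <= n)%N -> (u n < e%:E)%E.
Proof.
move=> u0 e e0.
have : \forall x \near (0 : \bar R)%E, (x < e%:E)%E.
  by apply: open_nbhs_nbhs; split; [exact: open_ereal_lt_ereal|rewrite /= lte_fin].
by move=> /u0[N _ hN]; exists N => n Nn; exact: hN.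
Qed.

Lemma cvge0P (R : realType) (u : (\bar R)^nat) : (forall n, 0 <= u n)%E ->
  (forall e : R, 0 < e -> exists N, forall n, (N <= n)%N -> (u n < e%:E)%E) ->
  (u @ \oo --> 0)%E.
Proof.
move=> u0 ue A /nbhs_EFin /nbhs_ballP[e /= e0 eA].
have [N HN] := ue e e0; exists N => // n /= Nn; have := HN n Nn; have := u0 n.
rewrite /=; case: (u n) => [r r0 re|//|//].
by apply: eA; rewrite /ball /= sub0r normrN ger0_norm.
Qed.

Lemma limn_einf_le (R : realType) (u : (\bar R)^nat) (M : \bar R) N :
  (forall n, (N <= n)%N -> (u n <= M)%E) -> (limn_einf u <= M)%E.
Proof.
move=> uM; rewrite limn_einf_lim; apply: lime_le; first exact: is_cvg_einfs.
apply: nearW => n; apply: le_trans (uM (maxn n N) (leq_maxr _ _)).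
by apply: ereal_inf_lbound; exists (maxn n N) => //=; exact: leq_maxl.
Qed.

Lemma ae_imply {disp} {T : measurableType disp} {R : realType}
    (mu : {measure set T -> \bar R}) (P Q : T -> Prop) :
  (forall x, P x -> Q x) -> {ae mu, forall x, P x} -> {ae mu, forall x, Q x}.
Proof. by move=> PQ; exact: filterS. Qed.

Lemma ae_imply2 {disp} {T : measurableType disp} {R : realType}
    (mu : {measure set T -> \bar R}) (P P' Q : T -> Prop) :
  (forall x, P x -> P' x -> Q x) -> {ae mu, forall x, P x} -> {ae mu, forall x, P' x} ->
  {ae mu, forall x, Q x}.
Proof. by move=> PQ; exact: filterS2. Qed.

Section L2_theory.
Context {disp : measure_display} {T : measurableType disp} {R : realType}.
Variables (mu : {measure set T -> \bar R}) (D : set T).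
Hypothesis mD : measurable D.
Implicit Types f g : T -> R.

Definition L2_ip f g : R := \int[mu]_(x in D) (f x * g x).

Let msqr f : measurable_fun D f -> measurable_fun D (fun x => (f x ^+ 2)%:E : \bar R).
Proof. by move=> mf; apply/measurable_EFinP/measurable_funX. Qed.

Lemma L2_measurable f : L2 mu D f -> measurable_fun D f.
Proof. by case. Qed.

Lemma L2_0 : L2 mu D (cst 0).
Proof.
split; first exact: measurable_cst.
by under eq_integral do rewrite expr0n /=; rewrite integral0.
Qed.

Lemma L2Z (r : R) f : L2 mu D f -> L2 mu D (fun x => r * f x).
Proof.
move=> [mf fy]; split; first exact: measurable_funM (measurable_cst _) mf.
under eq_integral do rewrite exprMn EFinM.
rewrite ge0_integralZl_EFin ?sqr_ge0//; first by rewrite lte_mul_pinfty// lee_fin sqr_ge0.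
- by move=> x _; rewrite lee_fin sqr_ge0.
- exact: msqr.
Qed.

Lemma integral_sqrD_le f g : measurable_fun D f -> measurable_fun D g ->
  (\int[mu]_(x in D) ((f x + g x) ^+ 2)%:E <=
   2%:E * \int[mu]_(x in D) (f x ^+ 2)%:E + 2%:E * \int[mu]_(x in D) (g x ^+ 2)%:E)%E.
Proof.
move=> mf mg.
apply: (@le_trans _ _
    (\int[mu]_(x in D) (2%:E * (f x ^+ 2)%:E + 2%:E * (g x ^+ 2)%:E))%E).
  apply: ge0_le_integral => //.
  - by move=> x _; rewrite lee_fin sqr_ge0.
  - by apply: msqr; exact: measurable_funD.
  - by apply: emeasurable_funD; apply: measurable_funeM; exact: msqr.
  - move=> x _; rewrite -!EFinM -EFinD lee_fin /=.
    by have := sqr_ge0 (f x - g x); nra.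
rewrite ge0_integralD//.
- rewrite !ge0_integralZl_EFin//.
  + by move=> x _; rewrite lee_fin sqr_ge0.
  + exact: msqr.
  + by move=> x _; rewrite lee_fin sqr_ge0.
  + exact: msqr.
- by move=> x _; rewrite -EFinM lee_fin mulr_ge0// sqr_ge0.
- by apply: measurable_funeM; exact: msqr.
- by move=> x _; rewrite -EFinM lee_fin mulr_ge0// sqr_ge0.
- by apply: measurable_funeM; exact: msqr.
Qed.

Lemma L2D f g : L2 mu D f -> L2 mu D g -> L2 mu D (f \+ g).
Proof.
move=> [mf fy] [mg gy]; split; first exact: measurable_funD.
apply: le_lt_trans (integral_sqrD_le mf mg) _.
by rewrite lte_add_pinfty// lte_mul_pinfty.
Qed.

Lemma L2_subspace : is_subspace (L2 mu D : set (T -> R^o)).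
Proof.
split; first exact: L2_0.
by move=> r u v Lu Lv; apply: L2D => //; exact: L2Z.
Qed.

Lemma L2_sqr_integrable f : L2 mu D f -> mu.-integrable D (fun x => (f x ^+ 2)%:E : \bar R).
Proof.
move=> [mf fy]; apply/integrableP; split; first exact: msqr.
by under eq_integral do rewrite gee0_abs ?lee_fin ?sqr_ge0//.
Qed.

Lemma L2M_integrable f g : L2 mu D f -> L2 mu D g ->
  mu.-integrable D (fun x => (f x * g x)%:E : \bar R).
Proof.
move=> Lf Lg.
apply: (@le_integrable _ _ _ _ _ mD _ (fun x => (f x ^+ 2 + g x ^+ 2)%:E : \bar R)).
- by apply/measurable_EFinP/measurable_funM; exact: L2_measurable.
- move=> x _; rewrite lee_fin /= [leRHS]ger0_norm ?addr_ge0 ?sqr_ge0//.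
  by rewrite ler_norml; have := sqr_ge0 (f x - g x); have := sqr_ge0 (f x + g x);
    move: (f x) (g x) => a b; nra.
- by have := integrableD mD (L2_sqr_integrable Lf) (L2_sqr_integrable Lg).
Qed.

Lemma L2_ip_semi_inner : semi_inner (L2 mu D : set (T -> R^o)) L2_ip.
Proof.
split=> [h Lh r f g Lf Lg|f g Lf Lg|f Lf].
- rewrite /L2_ip -RintegralZl//; last exact: L2M_integrable.
  rewrite -RintegralD//; last exact: L2M_integrable.
    by apply: eq_Rintegral => x _; rewrite mulrDl -mulrA.
  by have := L2M_integrable (L2Z r Lf) Lh; apply: eq_integrable => // x _;
    rewrite /= mulrA.
- by apply: eq_Rintegral => x _; rewrite mulrC.
- by apply: Rintegral_ge0 => x _; rewrite -expr2 sqr_ge0.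
Qed.

Lemma L2_ipE f : L2 mu D f -> (L2_ip f f)%:E = (\int[mu]_(x in D) ((f x) ^+ 2)%:E)%E.
Proof.
move=> [mf fy]; rewrite /L2_ip /Rintegral fineK.
  by apply: eq_integral => x _; rewrite expr2.
by rewrite ge0_fin_numE ?integral_ge0// => x _; rewrite lee_fin -expr2 sqr_ge0.
Qed.

Lemma sqdist_L2_ip f g : L2 mu D f -> L2 mu D g ->
  sqdist mu D f g = (L2_ip (f \- g) (f \- g))%:E.
Proof. by move=> Lf Lg; rewrite L2_ipE//; exact: (subspaceB L2_subspace). Qed.

Lemma L2_ip_eq0 f : L2 mu D f -> L2_ip f f = 0 -> f = cst 0 %[ae mu in D].
Proof.
move=> Lf f0; have := L2_ipE Lf; rewrite f0 => /esym i0.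
have [+ _] := ae_eq_integral_abs mu mD (msqr (L2_measurable Lf)).
have -> : (\int[mu]_(x in D) `|(f x ^+ 2)%:E| = 0)%E.
  by under eq_integral do rewrite gee0_abs ?lee_fin ?sqr_ge0//.
move=> /(_ erefl); apply: filterS => x /= /[apply] -[] /eqP.
by rewrite sqrf_eq0 => /eqP.
Qed.

Lemma L2_chebyshev f (a : R) : 0 < a -> L2 mu D f ->
  ((a ^+ 2)%:E * mu (D `&` [set x | (a <= `|f x|)%R]) <= (L2_ip f f)%:E)%E.
Proof.
move=> a0 Lf; have mf := L2_measurable Lf.
have mA : measurable (D `&` [set x | (a <= `|f x|)%R]).
  rewrite (_ : [set x | _] = [set x | (a%:E <= `|(f x)%:E|)%E])//.
  by apply: emeasurable_fun_c_infty => //; apply/measurableT_comp/measurable_EFinP.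
rewrite L2_ipE// -integral_cst//.
apply: (@le_trans _ _ (\int[mu]_(x in D `&` [set x | (a <= `|f x|)%R]) (f x ^+ 2)%:E)%E).
  apply: ge0_le_integral => //.
  - by move=> x _; rewrite lee_fin sqr_ge0.
  - by apply: measurable_funS (msqr mf).
  - move=> x [_ /= ax]; rewrite lee_fin -[f x ^+ 2]real_normK ?num_real//.
    by rewrite lerXn2r// nnegrE// ltW.
by apply: ge0_subset_integral => //; [exact: msqr|move=> x _; rewrite lee_fin sqr_ge0].
Qed.

Lemma sqdist_ge0 f g : (0 <= sqdist mu D f g)%E.
Proof. by apply: integral_ge0 => x _; rewrite lee_fin sqr_ge0. Qed.

Lemma sqdist_triangle f g h :
  measurable_fun D f -> measurable_fun D g -> measurable_fun D h ->
  (sqdist mu D f h <= 2%:E * sqdist mu D f g + 2%:E * sqdist mu D g h)%E.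
Proof.
move=> mf mg mh; apply: le_trans (integral_sqrD_le _ _); last 2 first.
- exact: (measurable_funB mf mg).
- exact: (measurable_funB mg mh).
by rewrite le_eqVlt; apply/orP; left; apply/eqP/eq_integral => x _; rewrite addrA subrK.
Qed.

Lemma sqdist_linear_le (r : R) f1 f2 g1 g2 :
  measurable_fun D f1 -> measurable_fun D f2 ->
  measurable_fun D g1 -> measurable_fun D g2 ->
  (sqdist mu D (fun x => r * f1 x + f2 x)%R (fun x => r * g1 x + g2 x)%R <=
   (2 * r ^+ 2)%R%:E * sqdist mu D f1 g1 + 2%:E * sqdist mu D f2 g2)%E.
Proof.
move=> mf1 mf2 mg1 mg2.
have -> : ((2 * r ^+ 2)%R%:E * sqdist mu D f1 g1 =
    2%:E * \int[mu]_(x in D) ((r * (f1 x - g1 x)) ^+ 2)%:E)%E.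
  rewrite EFinM -muleA; congr (_ * _)%E.
  under [RHS]eq_integral do rewrite exprMn EFinM.
  rewrite ge0_integralZl_EFin ?sqr_ge0//.
  - by move=> x _; rewrite lee_fin sqr_ge0.
  - exact/msqr/measurable_funB.
apply: le_trans (integral_sqrD_le _ _); last 2 first.
- by apply: measurable_funM; [exact: measurable_cst|exact: measurable_funB].
- exact: (measurable_funB mf2 mg2).
rewrite le_eqVlt; apply/orP; left; apply/eqP/eq_integral => x _; congr (_ ^+ 2)%:E; ring.
Qed.

Lemma L2_bounded f (M : R) : (mu D < +oo)%E -> measurable_fun D f ->
  (forall x, D x -> `|f x| <= M) -> L2 mu D f.
Proof.
move=> Dy mf fM; split => //; apply: (@le_lt_trans _ _ (\int[mu]_(x in D) (M ^+ 2)%:E)%E).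
  apply: ge0_le_integral => //.
  - by move=> x _; rewrite lee_fin sqr_ge0.
  - exact: msqr.
  - move=> x Dx; have {}fM := fM x Dx; rewrite lee_fin -[leLHS]real_normK ?num_real//.
    by rewrite lerXn2r// nnegrE (le_trans _ fM).
by rewrite integral_cst// lte_mul_pinfty// lee_fin sqr_ge0.
Qed.

Lemma L2_sum (I : finType) (f : I -> T -> R) :
  (forall i, L2 mu D (f i)) -> L2 mu D (fun x => \sum_i f i x).
Proof.
move=> Lf; rewrite (_ : (fun x => _) = \sum_i (f i : T -> R^o)).
  exact: (subspace_sum L2_subspace).
by apply/funext => x; rewrite fct_sumE.
Qed.

Lemma integrable_Rsum (I : Type) (r : seq I) (f : I -> T -> R) :
  (forall i, mu.-integrable D (EFin \o f i)) ->
  mu.-integrable D (EFin \o (fun x => \sum_(i <- r) f i x)).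
Proof.
move=> intf; have := integrable_sum mD r (fun i (_ : xpredT i) => intf i).
by apply: eq_integrable => // x _ /=; rewrite sumEFin.
Qed.

Lemma Rintegral_sum (I : Type) (r : seq I) (f : I -> T -> R) :
  (forall i, mu.-integrable D (EFin \o f i)) ->
  \int[mu]_(x in D) (\sum_(i <- r) f i x) = \sum_(i <- r) \int[mu]_(x in D) f i x.
Proof.
move=> intf; elim: r => [|i r IH].
  rewrite big_nil /Rintegral (eq_integral (cst 0%E)) ?integral0// => x _.
  by rewrite big_nil.
rewrite big_cons -IH -RintegralD//; last exact: integrable_Rsum.
by apply: eq_Rintegral => x _; rewrite big_cons.
Qed.

Lemma ae_le_Rintegral f g : mu.-integrable D (EFin \o f) -> mu.-integrable D (EFin \o g) ->
  {ae mu, forall x, D x -> f x <= g x} ->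
  \int[mu]_(x in D) f x <= \int[mu]_(x in D) g x.
Proof.
move=> intf intg fg; rewrite -subr_ge0 -RintegralB//.
have intB : mu.-integrable D (EFin \o (g \- f)) by have := integrableB mD intg intf.
have mB : measurable_fun D (g \- f) by exact/measurable_EFinP/(measurable_int _ intB).
rewrite /Rintegral (ae_eq_integral (fun x => `|g x - f x|%:E))//.
- by apply: fine_ge0; apply: integral_ge0.
- exact/measurable_EFinP.
- by apply/measurable_EFinP; exact: measurableT_comp.
- move: fg; apply: filterS => x fg Dx /=.
  by rewrite ger0_norm// subr_ge0 fg.
Qed.

Lemma ae_eq_Rintegral f g : mu.-integrable D (EFin \o f) -> mu.-integrable D (EFin \o g) ->
  {ae mu, forall x, D x -> f x = g x} ->
  \int[mu]_(x in D) f x = \int[mu]_(x in D) g x.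
Proof.
move=> intf intg fg; apply/eqP; rewrite eq_le !ae_le_Rintegral//.
  by move: fg; apply: filterS => x fg Dx; rewrite fg.
by move: fg; apply: filterS => x fg Dx; rewrite fg.
Qed.

Lemma L2_bounded_mul (k f : T -> R) (M : R) : measurable_fun D k ->
  {ae mu, forall x, D x -> `|k x| <= M} -> L2 mu D f -> L2 mu D (fun x => k x * f x).
Proof.
move=> mk kM Lf; have [mf fy] := Lf; split; first exact: measurable_funM.
apply: (@le_lt_trans _ _ (\int[mu]_(x in D) ((M * f x) ^+ 2)%:E)%E); last first.
  by have [] := L2Z M Lf.
apply: ae_ge0_le_integral => //.
- by move=> x _; rewrite lee_fin sqr_ge0.
- exact/msqr/measurable_funM.
- by move=> x _; rewrite lee_fin sqr_ge0.
- by apply: msqr; apply: measurable_funM => //; exact: measurable_cst.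
move: kM; apply: filterS => x kM Dx; have {}kM := kM Dx.
rewrite lee_fin !exprMn ler_wpM2r ?sqr_ge0// -[leLHS]real_normK ?num_real//.
by rewrite lerXn2r// nnegrE (le_trans _ kM).
Qed.

(* Riesz-Fischer: along a subsequence with squared increments at most [4^-k],
   AM-GM bounds the total variation at a point by
   [sum_k 2^-k + sum_k 2^k (increment)^2], which is integrable up to a
   constant. *)
Lemma L2_complete : complete_for (L2_ip : (T -> R^o) -> (T -> R^o) -> R) (L2 mu D).
Proof.
move=> f Lf cauchyf; have LB := subspaceB L2_subspace.
have /choice[N NP] k : exists N, forall p q, (N <= p)%N -> (N <= q)%N ->
    L2_ip (f p - f q) (f p - f q) < 4^-1 ^+ k.
  by have [|N HN] := cauchyf (4^-1 ^+ k); [rewrite exprn_gt0|exists N].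
(* Partial sums make the indices monotone while keeping [N k <= n k]. *)
pose n k := (\sum_(j < k.+1) N j)%N.
have Nn k : (N k <= n k)%N by rewrite /n big_ord_recr/= leq_addl.
have nS k : (n k <= n k.+1)%N by rewrite {2}/n big_ord_recr/= leq_addr.
have nh p k : (p <= k)%N -> (n p <= n k)%N.
  by move=> /subnK <-; elim: (k - p)%N => // j IH; exact: leq_trans IH (nS _).
pose h k : T -> R := f (n k); have Lh k : L2 mu D (h k) by exact: Lf.
pose de k : T -> R := h k.+1 \- h k; have Lde k : L2 mu D (de k) by exact: LB.
have mde k : measurable_fun D (fun x => (2 ^+ k * (de k x) ^+ 2)%:E : \bar R).
  apply/measurable_EFinP/measurable_funM; first exact: measurable_cst.
  exact/measurable_funX/L2_measurable.
have de0 k x : (0 <= (2 ^+ k * (de k x) ^+ 2)%:E)%E.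
  by rewrite lee_fin mulr_ge0 ?sqr_ge0// exprn_ge0.
pose G x := (\sum_(k <oo) (2 ^+ k * (de k x) ^+ 2)%:E)%E.
have mG : measurable_fun D G by apply: ge0_emeasurable_sum => // k x Dx _; exact: de0.
have Gy : (\int[mu]_(x in D) G x < +oo)%E.
  rewrite integral_nneseries//.
  (* $2^k\cdot4^{-k}=2/2^{k+1}$, the form summed by [epsilon_trick0]. *)
  apply: (@le_lt_trans _ _ (\sum_(k <oo) (2 / (2 ^ k.+1)%:R)%:E)%E); last first.
    by apply: le_lt_trans (epsilon_trick0 xpredT (ler0n R 2)) _; rewrite ltry.
  apply: lee_nneseries => [k _ _|k _]; first by apply: integral_ge0.
  under eq_integral do rewrite EFinM.
  rewrite ge0_integralZl_EFin//.
  - rewrite -L2_ipE// -EFinM lee_fin.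
    have /ltW de4 := NP k (n k.+1) (n k) (leq_trans (Nn k) (nS k)) (Nn k).
    have p2 : 0 < (2 : R) ^+ k by rewrite exprn_gt0.
    apply: le_trans (ler_wpM2l (ltW p2) de4) _.
    rewrite expnS natrM invfM mulrA mulfV// mul1r natrX -exprMn.
    by rewrite (_ : 2 * 4^-1 = 2^-1) ?exprVn//; field.
  - by move=> x _; rewrite lee_fin sqr_ge0.
  - exact/msqr/L2_measurable.
pose A := D `&` [set x | (G x < +oo)%E].
have mA : measurable A by apply: emeasurable_fun_infty_o.
have aeA : {ae mu, forall x, D x -> A x}.
  have iG : mu.-integrable D G.
    apply/integrableP; split => //; rewrite (eq_integral G)// => x _.
    by rewrite gee0_abs//; exact: nneseries_ge0.
  have := integrable_ae mD iG; apply: filterS => x Gx Dx; split => //=.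
  by have := Gx Dx; rewrite fin_numE => /andP[_]; rewrite ltey.
have cvgh x : A x -> cvgn (h ^~ x).
  move=> [Dx Gx].
  have hE : h ^~ x = (fun k => h 0%N x + series (de ^~ x) k).
    apply/funext => k; rewrite /series /= telescope_sumr// addrC subrK//.
  rewrite hE; apply: is_cvgD; first exact: is_cvg_cst.
  apply: normed_cvg; apply: nondecreasing_is_cvgn.
    by apply/nondecreasing_seqP => k; rewrite [leRHS]seriesS ler_wpDl//=.
  exists (2 + fine (G x)) => _ [k _ <-].
  have Gfin : G x \is a fin_num.
    by rewrite ge0_fin_numE//; exact: nneseries_ge0.
  (* AM-GM termwise: $|y|\le2^{-j}+2^jy^2$. *)
  apply: (@le_trans _ _ (\sum_(0 <= j < k) (2^-1 ^+ j + 2 ^+ j * de j x ^+ 2))).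
    apply: ler_sum => j _ /=.
    have a0 : 0 < (2 : R) ^+ j by rewrite exprn_gt0.
    rewrite exprVn; move: a0 (de j x : R); set a := 2 ^+ j => a0 y.
    rewrite -(ler_pM2l a0) mulrDr mulfV ?gt_eqF// mulrA.
    have := sqr_ge0 (a * `|y| - 1); rewrite -(real_normK (num_real y)).
    have := sqr_ge0 (a * `|y|); nra.
  rewrite big_split/= lerD//.
    have -> : \sum_(0 <= j < k) (2^-1 : R) ^+ j = 2 - 2 * 2^-1 ^+ k.
      elim: k => [|k IH]; first by rewrite big_geq// expr0; lra.
      by rewrite big_nat_recr//= IH exprS; lra.
    by rewrite gerBl mulr_ge0 ?exprn_ge0.
  rewrite -lee_fin fineK// -sumEFin.
  by apply: nneseries_lim_ge => j _ _; exact: de0.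
(* Cutting off the null set where [G] is infinite makes the sequence converge at every point of [D],
   so the limit is measurable. *)
pose hA k x := h k x * \1_A x; pose y x : R := limn (hA ^~ x).
have hAy x : D x -> hA ^~ x @ \oo --> y x.
  move=> Dx; rewrite /y; have [Ax|nAx] := pselect (A x).
    have -> : hA ^~ x = h ^~ x by apply/funext => k; rewrite /hA indicE mem_set// mulr1.
    exact: cvgh.
  have -> : hA ^~ x = cst 0 by apply/funext => k; rewrite /hA indicE memNset// mulr0.
  by rewrite lim_cst//; exact: cvg_cst.
have mhA k : measurable_fun D (hA k).
  by apply: measurable_funM; [exact: L2_measurable|exact: measurable_indic].
have my : measurable_fun D y by exact: (measurable_fun_cvg mhA hAy).
have mfy p : measurable_fun D (f p - y).
  by apply: measurable_funB => //; exact: L2_measurable.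
(* Fatou's lemma: the distance from [f p] to the limit is at most the lower limit of its distances
   to [h j], and [hA j] equals [h j] almost everywhere. *)
have key k p : (N k <= p)%N ->
    (\int[mu]_(x in D) ((f p - y) x ^+ 2)%:E <= (4^-1 ^+ k)%:E)%E.
  move=> kp; pose F j x := ((f p x - hA j x) ^+ 2)%:E.
  have mF j : measurable_fun D (F j).
    by apply: msqr; apply: measurable_funB => //; exact: L2_measurable.
  have F0 j x : D x -> (0 <= F j x)%E by rewrite lee_fin sqr_ge0.
  rewrite (_ : (\int[mu]_(x in D) _)%E = \int[mu]_(x in D) limn_einf (F ^~ x))%E.
    apply: le_trans (fatou mu mD mF F0) _; apply: (@limn_einf_le _ _ _ k) => j kj.
    rewrite (@ge0_ae_eq_integral _ _ _ _ _ _ (fun x => ((f p - h j) x ^+ 2)%:E))//.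
    - by rewrite -L2_ipE ?lee_fin ?ltW//; [apply: NP => //; exact: leq_trans (Nn _) (nh _ _ kj)|exact: LB].
    - exact/msqr/L2_measurable/LB.
    - by move=> x _; rewrite lee_fin sqr_ge0.
    - by move=> x _; rewrite lee_fin sqr_ge0.
    - apply: filterS aeA => x DA Dx; rewrite /F /hA indicE mem_set ?mulr1//.
      exact: DA.
  apply: eq_integral => x; rewrite inE => Dx.
  have Fy : F ^~ x @ \oo --> ((f p - y) x ^+ 2)%:E.
    apply: cvg_EFin; first by apply: nearW.
    have c : f p x - hA j x @[j --> \oo] --> f p x - y x.
      by apply: cvgB; [exact: cvg_cst|exact: hAy].
    by apply: (cvg_trans _ (cvgM c c)); apply: near_eq_cvg; apply: nearW.
  by rewrite (cvg_limn_einf_sup Fy).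
have Lfy p : (N 0%N <= p)%N -> L2 mu D (f p - y).
  by move=> Np; split => //; apply: le_lt_trans (key _ _ Np) _; rewrite ltry.
exists y.
  have -> : y = f (N 0%N) - (f (N 0%N) - y) by rewrite opprB addrC subrK.
  exact/LB/Lfy.
move=> e e0.
have [k _ ke] : \forall k \near \oo, (4^-1 : R) ^+ k < e.
  have : (fun k => (4^-1 : R) ^+ k) @ \oo --> (0 : R).
    by apply: cvg_expr; rewrite gtr0_norm// invf_lt1// ltr1n.
  by move/cvgr_lt; apply.
exists (N 0%N + N k)%N => p Np.
rewrite -lte_fin L2_ipE; last by apply/Lfy/(leq_trans _ Np); rewrite leq_addr.
apply: (@le_lt_trans _ _ (4^-1 ^+ k)%:E); last by rewrite lte_fin; exact: (ke k (leqnn k)).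
by apply: key; rewrite (leq_trans _ Np)// leq_addl.
Qed.

End L2_theory.

(** * Borel sets are Caratheodory measurable *)

Section caratheodory_criteria.
Context {R : realType}.
Local Open Scope ereal_scope.

(* Caratheodory's criterion for metric outer measures, relative to the level
   sets of a single function: the layers [B k.+1 `\` B k] two steps apart are
   separated, so their measures are summable. *)
Lemma caratheodory_separated (T : Type) (mu : {outer_measure set T -> \bar R})
    (h : T -> R) :
  (forall (s t : R) (X Y : set T), (s < t)%R -> (forall x, X x -> (h x <= s)%R) ->
     (forall y, Y y -> (t < h y)%R) -> mu X + mu Y <= mu (X `|` Y)) ->
  forall a : R, mu.-caratheodory [set x | (a < h x)%R].
Proof.
move=> sep a; apply: le_caratheodory_measurable => X; set H := [set x | _].
have [->|] := eqVneq (mu X) +oo; first by rewrite leey.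
rewrite -ltey => Xy.
(* Levels decreasing to [a]: the sets [B n] increase to the part of [X] in the half-space, and each
   is separated from the rest of [X]. *)
pose lev n : R := (a + n.+1%:R^-1)%R.
have levS n : (lev n.+1 < lev n)%R by rewrite ltrD2l ltf_pV2 ?posrE// ltr_nat.
pose B n := X `&` [set x | (lev n < h x)%R].
have BX n : B n `<=` X by move=> x [].
have BS n : B n `<=` B n.+1 by move=> x [Xx /= lx]; split => //=; exact: lt_trans lx.
pose r n := mu (B n.+1 `\` B n).
have r0 n : 0 <= r n by exact: outer_measure_ge0.
have BC n : mu (X `&` ~` H) + mu (B n) <= mu X.
  apply: (@le_trans _ _ (mu ((X `&` ~` H) `|` B n))); last first.
    by apply: le_outer_measure => x [[]|[]].
  apply: (sep a (lev n)).
  - by rewrite ltrDl.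
  - by move=> x [_ /negP]; rewrite -leNgt.
  - by move=> x [].
have rB n : r n.+1 + mu (B n) <= mu (B n.+2).
  apply: (@le_trans _ _ (mu ((B n.+2 `\` B n.+1) `|` B n))); last first.
    by apply: le_outer_measure => x [[]//|/BS/BS].
  apply: (sep (lev n.+1) (lev n)) => //.
  - by move=> x [[Xx _] nB]; rewrite leNgt; apply/negP => lx; apply: nB.
  - by move=> x [].
(* Keeping two consecutive sets on the right telescopes the even and the odd layers in one
   induction. *)
have sum_r n : \sum_(0 <= k < n) r k.+1 + (mu (B 0%N) + mu (B 1%N)) <=
    mu (B n) + mu (B n.+1).
  elim: n => [|n IH]; first by rewrite big_geq// add0e.
  rewrite big_nat_recr//= addeAC; apply: le_trans (leeD2r _ IH) _.
  by rewrite addeC addeA addeC leeD2l// rB.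
have sum_ry : \sum_(k <oo) r k.+1 < +oo.
  apply: (@le_lt_trans _ _ (mu X + mu X)); last exact: lte_add_pinfty.
  apply: lime_le; first by apply: is_cvg_nneseries.
  apply: nearW => n; apply: (@le_trans _ _ (mu (B n) + mu (B n.+1))).
    by apply: le_trans (sum_r n); rewrite leeDl// adde_ge0// outer_measure_ge0.
  by apply: leeD; apply: le_outer_measure.
have tail n : mu (X `&` H) <= mu (B n.+1) + \sum_(n <= k <oo) r k.+1.
  apply: (@le_trans _ _ (mu (B n.+1 `|`
      \bigcup_(k in ~` `I_n) (B k.+2 `\` B k.+1)))).
    apply: le_outer_measure => x [Xx Hx].
    have [m mP] : exists m, B m x.
      have e0 : (0 < h x - a)%R by rewrite subr_gt0.
      have [N _ hN] := near_infty_natSinv_lt (PosNum e0).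
      exists N; split => //=; rewrite /lev -ltrBrDl; exact: (hN N (leqnn N)).
    elim: m mP => [|m IH] mP.
      by left; elim: (n.+1) => // j; exact: BS.
    have [/IH//|nBm] := pselect (B m x).
    have [mn|nm] := leqP m n.
      by left; move: mn => /subnK <-; elim: (n - m)%N => // j; rewrite addSn; exact: BS.
    right; case: m nm nBm mP {IH} => // m nm nBm mP; exists m => //=.
    by apply/negP; rewrite -leqNgt.
  apply: le_trans (outer_measureU2 _ _ _) _; rewrite leeD2l//.
  exact: outer_measure_sigma_subadditive_tail.
apply/lee_addgt0Pr => e e0.
have tail0 := nneseries_tail_cvg sum_ry (fun k _ => r0 k.+1).
have [n /(_ n (leqnn n)) ne] := cvge0_lt tail0 e0.
apply: (@le_trans _ _ (mu (B n.+1) + e%:E + mu (X `&` ~` H))).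
  by rewrite leeD2r// (le_trans (tail n))// leeD2l// ltW.
by rewrite addeAC leeD2r// addeC BC.
Qed.

Section coordinate_half_spaces.
Variables (d : nat) (mu : {outer_measure set 'rV[R]_d -> \bar R}).
Local Notation T := (caratheodory_type mu).
Hypothesis mcoord : forall i (a : R), mu.-caratheodory [set x | (a < x 0%R i)%R].

Let measurable_box (q : {ffun 'I_d -> rat * rat}) :
  measurable ([set x | forall i,
    (ratr (q i).1 < x 0%R i < ratr (q i).2)%R] : set T).
Proof.
have mi i : measurable_fun [set: T] (fun x => x 0%R i).
  apply: (measurability _ (RGenOInfty.measurableE R)).
  move=> _ [_ [a ->] <-]; rewrite setTI.
  rewrite (_ : _ @^-1` _ = [set x : 'rV[R]_d | (a < x 0%R i)%R]); first exact: mcoord.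
  by apply/seteqP; split => x /=; rewrite in_itv/= andbT.
rewrite [X in measurable X](_ : _ = \bigcap_(i in [set: 'I_d])
    ((fun x : 'rV[R]_d => x 0%R i) @^-1` `](ratr (q i).1), (ratr (q i).2)[%classic)).
  apply: fin_bigcap_measurable => // i _.
  by rewrite -[X in measurable X]setTI; apply: mi => //; exact: measurable_itv.
apply/seteqP; split => x /= h i; first by move=> _; rewrite /= in_itv/= h.
by have := h i Logic.I; rewrite /= in_itv.
Qed.

(** Balls of the sup norm are boxes, so an open set is the union of the countably many rational
    boxes that it contains. *)
Lemma open_caratheodory (U : set 'rV[R]_d) : open U -> measurable (U : set T).
Proof.
move=> oU.
pose box (q : {ffun 'I_d -> rat * rat}) : set 'rV[R]_d :=
  [set x | forall i, (ratr (q i).1 < x 0%R i < ratr (q i).2)%R].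
have -> : U = \bigcup_q (if `[< box q `<=` U >] then box q else set0).
  apply/seteqP; split => [x Ux|x [q _]]; last by case: asboolP => // qU; exact: qU.
  have /nbhs_ballP[e /= e0 eU] := open_nbhs_nbhs (conj oU Ux).
  have /choice[q qP] : forall i : 'I_d, exists q : rat * rat,
      (x 0%R i - e < ratr q.1 < x 0%R i)%R /\ (x 0%R i < ratr q.2 < x 0%R i + e)%R.
    move=> i.
    have /rat_in_itvoo[q1 q1P] : (x 0%R i - e < x 0%R i)%R by rewrite ltrBlDr ltrDl.
    have /rat_in_itvoo[q2 q2P] : (x 0%R i < x 0%R i + e)%R by rewrite ltrDl.
    by exists (q1, q2); move: q1P q2P; rewrite !in_itv.
  exists [ffun i => q i] => //; rewrite asboolT.
    by move=> i; rewrite ffunE; have [/andP[_ ->] /andP[-> _]] := qP i.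
  move=> y yq; apply: eU; split => // i j; rewrite ord1 /ball /=.
  have := yq j; rewrite ffunE; have [/andP[h1 _] /andP[_ h2]] := qP j.
  move=> /andP[h3 h4]; rewrite distrC ltr_distl.
  by rewrite (lt_trans h1 h3) (lt_trans h4 h2).
apply: countable_bigcupT_measurable; first exact: countableP.
by move=> q; case: asboolP => // _; exact: measurable_box.
Qed.

Lemma continuous_caratheodory (f : 'rV[R]_d -> R) (D : set T) :
  continuous f -> measurable_fun D f.
Proof.
move=> cf; apply: (@measurable_funS _ _ _ _ setT) => //.
apply: (measurability _ (RGenOInfty.measurableE R)) => _ [_ [a ->] <-].
rewrite setTI; apply: open_caratheodory.
by apply: open_comp; [move=> x _; exact: cf|exact: interval_open].
Qed.

End coordinate_half_spaces.

Section cover_outer_theory.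
Context {T : pointedType}.
Variable zeta : set T -> \bar R.
Hypotheses (zeta0 : zeta set0 = 0) (zeta_ge0 : forall A, 0 <= zeta A).

Lemma cover_outer_le A : cover_outer zeta A <= zeta A.
Proof.
apply: ereal_inf_lbound; exists (fun k => if k is 0%N then A else set0).
  by move=> x Ax; exists 0%N.
rewrite (nneseries_split _ 1)//.
by rewrite add0n big_nat1 eseries0 ?adde0// => -[|k].
Qed.

(** Caratheodory's condition need only be checked against the gauge: split each member of a cover
    and sum. *)
Lemma cover_outer_split A H :
  (forall E, cover_outer zeta (E `&` H) + cover_outer zeta (E `&` ~` H) <= zeta E) ->
  cover_outer zeta (A `&` H) + cover_outer zeta (A `&` ~` H) <= cover_outer zeta A.
Proof.
move=> split_zeta; apply: le_ereal_inf_tmp => _ [F /= AF <-].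
have cover_ge0 E := cover_outer_ge0 zeta_ge0 E.
have sub C : cover_outer zeta (A `&` C) <= \sum_(k <oo) cover_outer zeta (F k `&` C).
  apply: le_trans (cover_outer_sigma_subadditive zeta_ge0 _).
  by apply: le_cover_outer; rewrite -setI_bigcupl; exact: setSI.
apply: le_trans (leeD (sub _) (sub _)) _; rewrite -nneseriesD//.
by apply: lee_nneseries => // k _ _; rewrite adde_ge0.
Qed.

End cover_outer_theory.

End caratheodory_criteria.

(** * Measurability of half-spaces for Lebesgue and Hausdorff measure *)

Section borel_sets.
Context {R : realType} {d : nat}.
Local Open Scope ereal_scope.

Definition open_box (a b : 'rV[R]_d) : set 'rV[R]_d :=
  [set x | forall i, (a 0%R i < x 0%R i < b 0%R i)%R].

Lemma leb_open_box (a b : 'rV[R]_d) : (forall i, a 0%R i <= b 0%R i)%R ->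
  leb (open_box a b) <= (\prod_(i < d) (b 0%R i - a 0%R i)%R)%:E.
Proof.
move=> ab; apply: le_trans (cover_outer_le box_volume0 box_volume_ge0 _) _.
by apply: ereal_inf_lbound; right; exists a, b.
Qed.

(** A hyperplane cuts a box into two boxes whose volumes add up. Since the boxes are open, the lower
    one must be enlarged slightly to contain the cut. *)
Lemma leb_half_space i (c : R) :
  (leb_outer R d).-caratheodory [set x : 'rV[R]_d | (c < x 0%R i)%R].
Proof.
apply: le_caratheodory_measurable => X; set H := [set x | _].
apply: (cover_outer_split box_volume_ge0) => E.
apply: le_ereal_inf_tmp => _ [[-> ->]|[a [b [ab -> ->]]]].
  by rewrite !set0I !(cover_outer0 box_volume0 box_volume_ge0) adde0.
(* The cut clamped to the side of the box, which covers planes missing the box. *)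
pose c' := Num.max (a 0%R i) (Num.min c (b 0%R i)).
have ac' : (a 0%R i <= c')%R by rewrite le_max lexx.
have c'b : (c' <= b 0%R i)%R by rewrite ge_max ab ge_min lexx orbT.
pose upd (y : 'rV[R]_d) (v : R) : 'rV[R]_d := \row_j (if j == i then v else y 0%R j).
have upd_id y : upd y (y 0%R i) = y.
  by apply/rowP => j; rewrite mxE; case: eqP => [->|].
pose P := (\prod_(j < d | j != i) (b 0 j - a 0 j))%R.
have vol v w : (\prod_(j < d) (upd b w 0 j - upd a v 0 j) = (w - v) * P)%R.
  rewrite (bigD1 i)//= !mxE eqxx; congr (_ * _)%R.
  by apply: eq_bigr => j /negbTE ji; rewrite !mxE ji.
have le_upd v w : (v <= w)%R -> forall j, (upd a v 0%R j <= upd b w 0%R j)%R.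
  by move=> vw j; rewrite !mxE; case: eqP.
have P0 : (0 <= P)%R by apply: prodr_ge0 => j _; rewrite subr_ge0.
apply/lee_addgt0Pr => e e0; pose e' := (e / (P + 1))%R.
have e'0 : (0 < e')%R by rewrite divr_gt0// ltr_wpDl.
have e'P : (e' * P <= e)%R.
  by rewrite /e' mulrAC ler_pdivrMr ?ltr_wpDl// ler_pM2l// lerDl.
have upper : leb (open_box a b `&` H) <= ((b 0%R i - c') * P)%:E.
  rewrite -vol upd_id; apply: le_trans (leb_open_box _); last first.
    by move=> j; have := le_upd _ _ c'b j; rewrite upd_id.
  apply: (le_cover_outer box_volume) => x [xab cx] j; rewrite !mxE.
  case: eqP => [->|_]; last exact: xab.
  have /andP[ax ->] := xab i; rewrite andbT gt_max ax/= gt_min.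
  by rewrite (cx : c < x 0 i)%R.
have lower : leb (open_box a b `&` ~` H) <= ((c' + e' - a 0%R i) * P)%:E.
  rewrite -vol upd_id; apply: le_trans (leb_open_box _); last first.
    move=> j; have := le_upd (a 0%R i) (c' + e')%R _ j; rewrite upd_id; apply.
    by rewrite ler_wpDr// ltW.
  apply: (le_cover_outer box_volume) => x [xab /negP]; rewrite -leNgt => xc j.
  rewrite !mxE; case: eqP => [->|_]; last exact: xab.
  have /andP[-> xb] /= := xab i; rewrite ltr_pwDr// le_max orbC le_min xc.
  by rewrite ltW.
apply: le_trans (leeD upper lower) _; rewrite -!EFinD lee_fin.
have -> : (\prod_(j < d) (b 0 j - a 0 j) = (b 0 i - a 0 i) * P)%R.
  by rewrite (bigD1 i).
by rewrite -mulrDl; move: e'P; lra.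
Qed.

Lemma leb_bounded_lty (A : set 'rV[R]_d) : bounded_set A -> leb A < +oo.
Proof.
move=> [M [_ AM]]; pose b : 'rV[R]_d := \row_j (`|M| + 2)%R.
apply: (@le_lt_trans _ _ (leb (open_box (- b)%R b))).
  apply: (le_cover_outer box_volume) => x Ax i; rewrite !mxE -ltr_norml.
  have xM : (`|x| <= `|M| + 1)%R.
    by apply: AM => //; rewrite ltr_pwDr// ler_norm.
  apply: (@le_lt_trans _ _ (`|M| + 1)%R); last by rewrite ltrD2l ltr1n.
  apply: le_trans xM; rewrite [leRHS]mx_normrE.
  by apply/bigmax_geP; right; exists (0%R, i).
apply: le_lt_trans (leb_open_box _) (ltry _) => i.
by rewrite !mxE (@le_trans _ _ 0%R)// ?oppr_le0 addr_ge0.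
Qed.

Lemma coord_le_enorm (x : 'rV[R]_d) i : (`|x 0 i| <= enorm x)%R.
Proof.
rewrite -sqrtr_sqr ler_wsqrtr// /dotp (bigD1 i)//= -expr2 lerDl.
by apply: sumr_ge0 => j _; rewrite -expr2 sqr_ge0.
Qed.

Lemma hausdorff_gauge_separated s (delta : R) (F X Y : set 'rV[R]_d) :
  (forall x y, X x -> Y y -> delta < enorm (x - y))%R ->
  F `&` X !=set0 -> F `&` Y !=set0 -> hausdorff_gauge s delta F = +oo.
Proof.
move=> sep [x [Fx Xx]] [y [Fy Yy]]; rewrite /hausdorff_gauge asboolF; last first.
  by move=> F0; rewrite F0 in Fx.
rewrite ifF//; apply/negbTE; rewrite -ltNge.
apply: (@lt_le_trans _ _ (enorm (x - y))%:E); first by rewrite lte_fin sep.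
by apply: ereal_sup_ubound; exists (x, y).
Qed.

(** A member of a cover meeting both sets has diameter above [delta] and costs [+oo]; the other
    members serve at most one of the two sets. *)
Lemma cover_outer_separated s (delta : R) (X Y : set 'rV[R]_d) :
  (forall x y, X x -> Y y -> delta < enorm (x - y))%R ->
  cover_outer (hausdorff_gauge s delta) X + cover_outer (hausdorff_gauge s delta) Y
  <= cover_outer (hausdorff_gauge s delta) (X `|` Y).
Proof.
move=> sep; apply: le_ereal_inf_tmp => _ [F /= XYF <-].
have z0 := @hausdorff_gauge0 R d s delta.
have z_ge0 := @hausdorff_gauge_ge0 R d s delta.
pose G Z k := if `[< F k `&` Z !=set0 >] then F k else set0.
have GP Z : Z `<=` X `|` Y -> cover_outer (hausdorff_gauge s delta) Z <=
    \sum_(k <oo) hausdorff_gauge s delta (G Z k).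
  move=> ZXY; apply: ereal_inf_lbound; exists (G Z) => //= x Zx.
  have [k _ Fx] := XYF _ (ZXY _ Zx); exists k => //.
  by rewrite /G asboolT//; exists x.
apply: le_trans (leeD (GP X _) (GP Y _)) _; [by left|by right|].
rewrite -nneseriesD//; apply: lee_nneseries => [k _ _|k _]; first by rewrite adde_ge0.
rewrite /G; case: asboolP => FX; case: asboolP => FY; rewrite ?z0 ?adde0 ?add0e//.
by rewrite (hausdorff_gauge_separated s sep FX FY) leey.
Qed.

Lemma le_cover_outer_delta s (delta delta' : R) (X : set 'rV[R]_d) :
  (delta' <= delta)%R ->
  cover_outer (hausdorff_gauge s delta) X <= cover_outer (hausdorff_gauge s delta') X.
Proof.
move=> dd; apply: le_ereal_inf_tmp => _ [F /= XF <-].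
apply: (@le_trans _ _ (\sum_(k <oo) hausdorff_gauge s delta (F k))).
  by apply: ereal_inf_lbound; exists F.
apply: lee_nneseries => [k _ _|k _]; first exact: hausdorff_gauge_ge0.
rewrite /hausdorff_gauge; case: ifP => // _; case: (leP _ delta'%:E) => h.
  by rewrite (le_trans h)// lee_fin.
by rewrite leey.
Qed.

Lemma hausdorff_half_space i (c : R) :
  (surf_outer R d).-caratheodory [set x : 'rV[R]_d | (c < x 0%R i)%R].
Proof.
apply: (@caratheodory_separated _ _ _ (fun x : 'rV[R]_d => x 0%R i)) => s t X Y st Xs Yt.
set Z := (leRHS).
have [->|] := eqVneq Z +oo; first by rewrite leey.
rewrite -ltey => Zy; pose co delta := cover_outer (@hausdorff_gauge R d d.-1 delta).
have co_ge0 delta A : 0 <= co delta A.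
  exact/cover_outer_ge0/hausdorff_gauge_ge0.
(* Independent scales for [X] and [Y] allow the two suprema to be taken one after the other; the
   common scale [m] is also at most the gap [t - s]. *)
have sep delta delta' : (0 < delta)%R -> (0 < delta')%R -> co delta X + co delta' Y <= Z.
  move=> d0 d0'; pose m := Num.min (Num.min delta delta') (t - s)%R.
  apply: (@le_trans _ _ (co m X + co m Y)).
    by apply: leeD; apply: le_cover_outer_delta; rewrite !ge_min lexx ?orbT.
  apply: le_trans (@cover_outer_separated _ m X Y _) _.
    move=> x y /Xs xs /Yt ty; apply: (@le_lt_trans _ _ (t - s)%R).
      by rewrite ge_min lexx orbT.
    apply: lt_le_trans (coord_le_enorm _ i).
    by rewrite !mxE distrC (lt_le_trans _ (ler_norm _))// ltr_leB.
  apply: ereal_sup_ubound; exists m => //=.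
  by rewrite !lt_min d0 d0' subr_gt0.
have fin A : 0 <= A -> A <= Z -> A \is a fin_num.
  by move=> A0 AZ; rewrite ge0_fin_numE// (le_lt_trans AZ).
have Yfin delta : (0 < delta)%R -> co delta Y \is a fin_num.
  by move=> d0; apply: fin => //; apply: le_trans (sep _ _ d0 d0); rewrite leeDr.
have half delta : (0 < delta)%R -> hausdorff d.-1 X + co delta Y <= Z.
  move=> d0; rewrite -leeBrDr ?Yfin//; apply: ge_ereal_sup => _ [delta' d0' <-].
  by rewrite leeBrDr ?Yfin// sep.
have hX : hausdorff d.-1 X \is a fin_num.
  apply: fin; first exact: (outer_measure_ge0 (surf_outer R d)).
  by apply: le_trans (half _ ltr01); rewrite leeDl.
rewrite addeC -leeBrDr//; apply: ge_ereal_sup => _ [delta d0 <-].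
by rewrite leeBrDr// addeC half.
Qed.

End borel_sets.

(** * Sobolev spaces *)

Section smooth_functions.
Context {R : realType} {d : nat}.
Implicit Types f g : 'rV[R]_d -> R.

Lemma smooth_continuous f : smooth f -> continuous f.
Proof. by move=> /(_ [::])[]. Qed.

Lemma smooth_partial_continuous f i : smooth f -> continuous (partial i f).
Proof. by move=> /(_ [:: i])[]. Qed.

Lemma smooth0 : smooth (cst 0 : 'rV[R]_d -> R).
Proof.
have E s : foldr partial (cst 0 : 'rV[R]_d -> R) s = cst 0.
  elim: s => //= i s ->; apply/funext => x; exact: derive_cst.
by move=> s; rewrite E; split=> [|i x]; [exact: cst_continuous|exact: derivable_cst].
Qed.

Lemma foldr_partial_linear (r : R) f g s : smooth f -> smooth g ->
  foldr partial (fun x => r * f x + g x) s =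
  (fun x => r * foldr partial f s x + foldr partial g s x).
Proof.
move=> sf sg; elim: s => //= i s ->; apply/funext => x.
have df := (sf s).2 i x; have dg := (sg s).2 i x.
by have := deriveD (derivableZ (k := r) df) dg; rewrite deriveZ// => ->.
Qed.

Lemma smooth_linear (r : R) f g : smooth f -> smooth g -> smooth (fun x => r * f x + g x).
Proof.
move=> sf sg s; rewrite foldr_partial_linear//.
have [cf df] := sf s; have [cg dg] := sg s; split=> [x|i x].
  exact: (cvgD (cvgM (cvg_cst r) (cf x)) (cg x)).
by apply: derivableD => //; exact: derivableZ.
Qed.

Lemma partial_linear (r : R) f g i : smooth f -> smooth g ->
  partial i (fun x => r * f x + g x) = (fun x => r * partial i f x + partial i g x).
Proof. by move=> sf sg; have := foldr_partial_linear r [:: i] sf sg. Qed.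

End smooth_functions.

Section sobolev_space.
Context {R : realType} {d : nat}.
Variable Omega : set 'rV[R]_d.
Hypotheses (openO : open Omega) (bddO : bounded_set Omega).

Local Notation mu := (dx R d).
Local Notation ip := (L2_ip mu Omega).
Local Notation scalar := ('rV[R]_d -> R^o).

Lemma measurable_domain : measurable (Omega : set (lebesgueT R d)).
Proof. exact: (open_caratheodory (@leb_half_space R d)). Qed.

Let mO := measurable_domain.

Lemma continuous_measurable_domain (f : 'rV[R]_d -> R) : continuous f ->
  measurable_fun (Omega : set (lebesgueT R d)) f.
Proof. exact: (continuous_caratheodory (@leb_half_space R d)). Qed.

(** [Omega] has finite measure and lies in a compact box, on which [f] is bounded. *)
Lemma continuous_L2 (f : 'rV[R]_d -> R) : continuous f -> L2 mu Omega f.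
Proof.
move=> cf; have mf := continuous_measurable_domain cf.
have [M [_ OM]] := bddO.
pose B : set 'rV[R]_d := [set v | forall i, v ord0 i \in `[(- (`|M| + 1)), (`|M| + 1)]].
have cB : compact B.
  apply: (@rV_compact _ _ (fun=> `[(- (`|M| + 1)), (`|M| + 1)]%classic)) => _.
  exact: segment_compact.
have OB : Omega `<=` B.
  move=> x Ox i; rewrite in_itv/= -ler_norml.
  have xM : `|x| <= `|M| + 1 by apply: OM => //; rewrite ltr_pwDr// ler_norm.
  apply: le_trans xM; rewrite [leRHS]mx_normrE.
  by apply/bigmax_geP; right; exists (ord0, i).
have cfB : compact (f @` B).
  by apply: continuous_compact => //; apply: continuous_subspaceT.
have [N [_ fN]] := compact_bounded cfB.
apply: (@L2_bounded _ _ _ mu Omega mO f (`|N| + 1)) => //; first exact: leb_bounded_lty.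
move=> x Ox; apply: fN; first by rewrite ltr_pwDr// ler_norm.
by exists x => //; exact: OB.
Qed.

Let ip_semi_inner := L2_ip_semi_inner mu mO : semi_inner (L2 mu Omega : set scalar) ip.
Let subL2 := L2_subspace mu mO : is_subspace (L2 mu Omega : set scalar).

Lemma test_function_L2 phi : test_function Omega phi -> L2 mu Omega phi.
Proof. by move=> [/smooth_continuous/continuous_L2]. Qed.

Lemma test_function_partial_L2 phi i : test_function Omega phi ->
  L2 mu Omega (partial i phi).
Proof. by move=> [sphi _]; apply: continuous_L2; exact: smooth_partial_continuous. Qed.

Lemma jet_linear1 (r : R) (u v : jet R d) :
  (r *: u + v).1 = (fun x => r * u.1 x + v.1 x).
Proof. by []. Qed.

Lemma jet_linear2 (r : R) (u v : jet R d) i :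
  (r *: u + v).2 i = (fun x => r * u.2 i x + v.2 i x).
Proof. by []. Qed.

Lemma H1_subspace : is_subspace (H1 Omega).
Proof.
split.
  split; first exact: L2_0.
  move=> i; split; first exact: L2_0.
  move=> phi tphi.
  have := linear_on0 subL2 (semi_inner_linl ip_semi_inner (test_function_L2 tphi)).
  have := linear_on0 subL2
    (semi_inner_linl ip_semi_inner (test_function_partial_L2 i tphi)).
  by rewrite /L2_ip /= => -> ->; rewrite oppr0.
move=> r u v [Lu Hu] [Lv Hv]; split.
  by rewrite jet_linear1; exact: (subL2.2 r u.1 v.1 Lu Lv).
move=> i; have [Lui wu] := Hu i; have [Lvi wv] := Hv i.
rewrite jet_linear1 jet_linear2; split; first exact: (subL2.2 r (u.2 i) (v.2 i) Lui Lvi).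
move=> phi tphi.
have := semi_inner_linl ip_semi_inner (test_function_L2 tphi) r Lui Lvi.
have := semi_inner_linl ip_semi_inner (test_function_partial_L2 i tphi) r Lu Lv.
have := wu _ tphi; have := wv _ tphi; rewrite /L2_ip /= => -> -> -> ->; ring.
Qed.

Definition H1_ip (u v : jet R d) : R :=
  ip u.1 v.1 + \sum_(i < d) ip (u.2 i) (v.2 i).

Lemma H1_ip_semi_inner : semi_inner (H1 Omega) H1_ip.
Proof.
apply: semi_innerD.
  by apply: (semi_inner_comp _ _ ip_semi_inner) => // u [].
apply: semi_inner_sum => i.
by apply: (semi_inner_comp (f := fun u : jet R d => u.2 i) _ _ ip_semi_inner) => // u [_ /(_ i)[]].
Qed.

Lemma H1_ip_ge1 u : H1 Omega u -> ip u.1 u.1 <= H1_ip u u.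
Proof.
move=> [_ Hu]; rewrite lerDl; apply: sumr_ge0 => i _.
by apply: (semi_inner_ge0 ip_semi_inner); have [] := Hu i.
Qed.

Lemma H1_ip_ge2 u i : H1 Omega u -> ip (u.2 i) (u.2 i) <= H1_ip u u.
Proof.
move=> [Lu Hu]; rewrite /H1_ip (bigD1 i)//= addrCA lerDl addr_ge0//.
  exact: (semi_inner_ge0 ip_semi_inner).
by apply: sumr_ge0 => j _; apply: (semi_inner_ge0 ip_semi_inner); have [] := Hu j.
Qed.

Lemma H1normE u : H1 Omega u -> H1norm Omega u ^+ 2 = H1_ip u u.
Proof.
move=> Hu; rewrite /H1norm sqr_sqrtr//.
rewrite addr_ge0//; first by apply: Rintegral_ge0 => x _; rewrite sqr_ge0.
by apply: sumr_ge0 => i _; apply: Rintegral_ge0 => x _; rewrite sqr_ge0.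
Qed.

(** Used with test functions for [h], to pass to the limit in the identity defining weak
    derivatives. *)
Lemma L2_ip_cvg (x : nat -> scalar) (y h : scalar) :
  (forall n, L2 mu Omega (x n)) -> L2 mu Omega y -> L2 mu Omega h ->
  (forall e, 0 < e -> exists N, forall n, (N <= n)%N -> ip (x n - y) (x n - y) < e) ->
  forall e, 0 < e -> exists N, forall n, (N <= n)%N -> `|ip (x n) h - ip y h| < e.
Proof.
move=> Lx Ly Lh xy e e0.
have hh0 := semi_inner_ge0 ip_semi_inner Lh.
have [|N HN] := xy (e ^+ 2 / (ip h h + 1)).
  by rewrite divr_gt0 ?exprn_gt0// ltr_wpDl.
exists N => n /HN; rewrite ltr_pdivlMr ?ltr_wpDl// => xye.
have Ld := subspaceB subL2 (Lx n) Ly.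
rewrite -(linear_onB subL2 (semi_inner_linl ip_semi_inner Lh))//.
rewrite -(@ltr_pXn2r _ 2)// ?nnegrE ?ltW// real_normK ?num_real//.
apply: le_lt_trans xye; apply: le_trans (semi_inner_cauchy_schwarz subL2 ip_semi_inner Ld Lh) _.
by rewrite ler_wpM2l ?lerDl// (semi_inner_ge0 ip_semi_inner).
Qed.

Lemma H1_complete : complete_for H1_ip (H1 Omega).
Proof.
move=> x Hx cauchyx; have HB := subspaceB H1_subspace.
have L1 n : L2 mu Omega (x n).1 by have [] := Hx n.
have Li i n : L2 mu Omega ((x n).2 i) by have [_ /(_ i)[]] := Hx n.
have [||y1 Ly1 xy1] := L2_complete (mu := mu) mO (x := fun n => (x n).1) => //.
  move=> e /cauchyx[N HN]; exists N => m n Nm Nn.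
  exact: le_lt_trans (H1_ip_ge1 (HB _ _ (Hx m) (Hx n))) (HN m n Nm Nn).
have /choice[y2 y2P] i : exists y : scalar, L2 mu Omega y /\ forall e, 0 < e ->
    exists N, forall n, (N <= n)%N -> ip ((x n).2 i - y) ((x n).2 i - y) < e.
  have [||y Ly xy] := L2_complete (mu := mu) mO (x := fun n => (x n).2 i) => //; last by exists y.
  move=> e /cauchyx[N HN]; exists N => m n Nm Nn.
  exact: le_lt_trans (H1_ip_ge2 i (HB _ _ (Hx m) (Hx n))) (HN m n Nm Nn).
exists (y1, y2).
  split => // i; have [Lyi xyi] := y2P i; split => // phi tphi.
  have Lphi := test_function_L2 tphi; have Lp := test_function_partial_L2 i tphi.
  apply/eqP; rewrite -subr_eq0 opprK -normr_le0; apply/ler_addgt0Pl => e e0.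
  have e2 : 0 < e / 2 by rewrite divr_gt0.
  have [N1 H1] := L2_ip_cvg L1 Ly1 Lp xy1 e2.
  have [N2 H2] := L2_ip_cvg (Li i) Lyi Lphi xyi e2.
  have {H1} := H1 (maxn N1 N2) (leq_maxl _ _); have {H2} := H2 (maxn N1 N2) (leq_maxr _ _).
  move: (maxn N1 N2) => n h2 h1; have [_ /(_ i)[_ /(_ _ tphi)]] := Hx n.
  move: h1 h2; rewrite /L2_ip /=.
  rewrite !ltr_norml ler_norml addr0 => /andP[h1 h2] /andP[h3 h4] h5.
  by apply/andP; split; lra.
(* One share for the function and one for each of its [d] partial derivatives. *)
move=> e e0; pose e' := e / d.+1%:R.
have e'0 : 0 < e' by rewrite divr_gt0.
have [N1 HN1] := xy1 e' e'0.
have /choice[N2 HN2] i : exists N, forall n, (N <= n)%N ->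
    ip ((x n).2 i - y2 i) ((x n).2 i - y2 i) < e' by have [_] := y2P i; exact.
exists (N1 + \sum_i N2 i)%N => n Nn.
have -> : e = e' + \sum_(i < d) e'.
  by rewrite sumr_const card_ord -mulrS -[_ *+ d.+1]mulr_natr divfK// pnatr_eq0.
apply: ltr_leD; first by apply: HN1; rewrite (leq_trans _ Nn)// leq_addr.
apply: ler_sum => i _; apply/ltW/HN2; rewrite (leq_trans _ Nn)//.
by rewrite (bigD1 i)//= addnCA leq_addr.
Qed.

End sobolev_space.

(** * Closedness of the zero-trace condition *)

Section trace_zero.
Context {R : realType} {d : nat}.
Variable Omega : set 'rV[R]_d.
Hypotheses (openO : open Omega) (bddO : bounded_set Omega).
Variable S : set 'rV[R]_d.
Hypothesis mS : measurable (S : set (surfaceT R d)).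

Local Notation mu := (dx R d).
Let mO := measurable_domain openO.

Let lin_lt (k e : R) (a b : \bar R) : 0 <= k -> (0 <= a -> 0 <= b -> a < e%:E -> b < e%:E ->
  k%:E * a + 2%:E * b < ((k + 2) * e)%:E)%E.
Proof.
move=> k0; case: a => [a||]//; case: b => [b||]//; rewrite !lee_fin !lte_fin => a0 b0 ae be.
change (k * a + 2 * b < (k + 2) * e)%R.
have : k * a <= k * e by rewrite ler_wpM2l// ltW.
lra.
Qed.

Lemma trace0P (u : jet R d) : is_trace Omega S u (cst 0) <->
  forall e : R, 0 < e -> exists psi : 'rV[R]_d -> R,
    [/\ smooth psi, (sqdist mu Omega psi u.1 < e%:E)%E,
        forall i, (sqdist mu Omega (partial i psi) (u.2 i) < e%:E)%E &
        (sqdist (surf R d) S psi (cst 0%R) < e%:E)%E].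
Proof.
split=> [[_ [phi [sphi /cvge0_lt phi1 phi2 /cvge0_lt phiS]]] e e0|h].
  have [N1 H1] := phi1 e e0; have [N3 H3] := phiS e e0.
  have /choice[N2 H2] i := cvge0_lt (phi2 i) e0.
  pose n := (N1 + N3 + \sum_i N2 i)%N.
  exists (phi n); split => //.
  - by apply: H1; rewrite /n -addnA leq_addr.
  - by move=> i; apply: H2; rewrite /n (bigD1 i)//= addnCA leq_addr.
  - by apply: H3; rewrite /n addnAC leq_addl.
split; first exact: L2_0.
have inv0 (k : nat) : 0 < k.+1%:R^-1 :> R by rewrite invr_gt0.
have /choice[phi phiP] (k : nat) := h _ (inv0 k).
have small (e : R) : 0 < e -> exists N, forall n, (N <= n)%N -> n.+1%:R^-1 < e.
  move=> e0; have [N _ hN] := near_infty_natSinv_lt (PosNum e0).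
  by exists N => n Nn; exact: hN.
exists phi; split=> [k|| i |].
- by have [] := phiP k.
- apply: cvge0P => [n|e /small[N HN]]; first exact: sqdist_ge0.
  by exists N => n /HN ne; have [_ + _ _] := phiP n; move/lt_trans; apply; rewrite lte_fin.
- apply: cvge0P => [n|e /small[N HN]]; first exact: sqdist_ge0.
  by exists N => n /HN ne; have [_ _ /(_ i) + _] := phiP n; move/lt_trans; apply; rewrite lte_fin.
- apply: cvge0P => [n|e /small[N HN]]; first exact: sqdist_ge0.
  by exists N => n /HN ne; have [_ _ _ +] := phiP n; move/lt_trans; apply; rewrite lte_fin.
Qed.

Lemma H1_0_subspace : is_subspace (H1_0 Omega S).
Proof.
have subH := H1_subspace openO bddO; split.
  split; first exact: subH.1.
  apply/trace0P => e e0; exists (cst 0).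
  have sq0 disp (T : measurableType disp) (m : {measure set T -> \bar R}) D :
      (sqdist m D (cst 0%R) (cst 0%R) < e%:E)%E.
    by rewrite /sqdist; under eq_integral do rewrite /= subrr expr0n; rewrite integral0 lte_fin.
  split; [exact: smooth0|exact: sq0| |exact: sq0].
  move=> i; rewrite (_ : partial i (cst 0) = cst 0); first exact: sq0.
  by apply/funext => x; exact: derive_cst.
move=> r u v [Hu /trace0P tu] [Hv /trace0P tv]; split; first exact: subH.2.
apply/trace0P => e e0; pose e' := e / (2 * r ^+ 2 + 2).
have D0 : 0 < 2 * r ^+ 2 + 2 by rewrite ltr_wpDl// mulr_ge0// sqr_ge0.
have e'0 : 0 < e' by exact: divr_gt0.
have eE : e = (2 * r ^+ 2 + 2) * e' by rewrite mulrC divfK// gt_eqF.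
have r20 : 0 <= 2 * r ^+ 2 by rewrite mulr_ge0// sqr_ge0.
have [f [sf f1 f2 fS]] := tu _ e'0; have [g [sg g1 g2 gS]] := tv _ e'0.
have [Lu Hu2] := Hu; have [Lv Hv2] := Hv.
exists (fun x => r * f x + g x); split; first exact: smooth_linear.
- have := @sqdist_linear_le _ _ _ mu Omega mO r f g u.1 v.1.
  rewrite eE jet_linear1 => le_sq; apply: le_lt_trans (le_sq _ _ _ _) _.
  + by apply: continuous_measurable_domain; exact: smooth_continuous.
  + by apply: continuous_measurable_domain; exact: smooth_continuous.
  + exact: L2_measurable Lu.
  + exact: L2_measurable Lv.
  + by apply: lin_lt => //; exact: sqdist_ge0.
- move=> i; rewrite partial_linear// eE jet_linear2.
  have := @sqdist_linear_le _ _ _ mu Omega mO r (partial i f) (partial i g) (u.2 i) (v.2 i).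
  move=> le_sq; apply: le_lt_trans (le_sq _ _ _ _) _.
  + by apply: continuous_measurable_domain; exact: smooth_partial_continuous.
  + by apply: continuous_measurable_domain; exact: smooth_partial_continuous.
  + exact: L2_measurable (Hu2 i).1.
  + exact: L2_measurable (Hv2 i).1.
  + by apply: lin_lt => //; exact: sqdist_ge0.
- rewrite eE (_ : cst 0 = fun x => r * (cst 0 x) + cst 0 x); last first.
    by apply/funext => x /=; rewrite mulr0 addr0.
  have := @sqdist_linear_le _ _ _ (surf R d) S mS r f g (cst 0) (cst 0).
  move=> le_sq; apply: le_lt_trans (le_sq _ _ _ _) _.
  + by apply: (continuous_caratheodory (@hausdorff_half_space R d)); exact: smooth_continuous.
  + by apply: (continuous_caratheodory (@hausdorff_half_space R d)); exact: smooth_continuous.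
  + exact: measurable_cst.
  + exact: measurable_cst.
  + by apply: lin_lt => //; exact: sqdist_ge0.
Qed.

Lemma H1_0_complete : complete_for (H1_ip Omega) (H1_0 Omega S).
Proof.
move=> x Hx cauchyx; have Hx1 n : H1 Omega (x n) by have [] := Hx n.
have [y Hy xy] := H1_complete openO bddO Hx1 cauchyx; exists y => //; split => //.
(* An approximant of a nearby [x n] also approximates [y], and its boundary condition is unchanged.
   The $4$ comes from $(s+t)^2\le2s^2+2t^2$. *)
apply/trace0P => e e0; pose e' := e / 4.
have e'0 : 0 < e' by exact: divr_gt0.
have eE : e = (2 + 2) * e' by rewrite /e'; field.
have [n /(_ n (leqnn n)) xn] := xy e' e'0.
have [_ /trace0P tn] := Hx n; have [psi [spsi p1 p2 pS]] := tn e' e'0.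
have Hd := subspaceB (H1_subspace openO bddO) (Hx1 n) Hy.
have [Lx Lx2] := Hx1 n; have [Ly Ly2] := Hy.
exists psi; split => //.
- rewrite eE; have := @sqdist_triangle _ _ _ mu Omega mO psi (x n).1 y.1.
  move=> le_sq; apply: le_lt_trans (le_sq _ (L2_measurable Lx) _) _.
  + by apply: continuous_measurable_domain; exact: smooth_continuous.
  + exact: L2_measurable Ly.
  + apply: lin_lt => //; try exact: sqdist_ge0.
    by rewrite (sqdist_L2_ip mO)// lte_fin; exact: le_lt_trans (H1_ip_ge1 openO Hd) xn.
- move=> i; rewrite eE.
  have := @sqdist_triangle _ _ _ mu Omega mO (partial i psi) ((x n).2 i) (y.2 i).
  move=> le_sq; apply: le_lt_trans (le_sq _ (L2_measurable (Lx2 i).1) _) _.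
  + by apply: continuous_measurable_domain; exact: smooth_partial_continuous.
  + exact: L2_measurable (Ly2 i).1.
  + apply: lin_lt => //; try exact: sqdist_ge0.
    rewrite (sqdist_L2_ip mO)//; [|exact: (Lx2 i).1|exact: (Ly2 i).1].
    by rewrite lte_fin; exact: le_lt_trans (H1_ip_ge2 openO i Hd) xn.
- by apply: lt_le_trans pS _; rewrite lee_fin /e'; lra.
Qed.

End trace_zero.

(** * Bilinear forms *)

Section vector_fields.
Context {R : realType} {d : nat}.
Variable Omega : set 'rV[R]_d.
Hypotheses (openO : open Omega) (bddO : bounded_set Omega).

Definition vH1_ip (u v : vjet R d) : R := \sum_(i < d) H1_ip Omega (u i) (v i).

Lemma vH1_subspace : is_subspace (vH1 Omega).
Proof.
have subH := H1_subspace openO bddO.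
by split=> [i|r u v Hu Hv i]; [exact: subH.1|exact: (subH.2 r)].
Qed.

Lemma vH1_ip_ge u i : vH1 Omega u -> H1_ip Omega (u i) (u i) <= vH1_ip u u.
Proof.
move=> Hu; rewrite /vH1_ip (bigD1 i)//= lerDl; apply: sumr_ge0 => j _.
by rewrite (semi_inner_ge0 (H1_ip_semi_inner openO)).
Qed.

Lemma vH1normE u : vH1 Omega u -> vH1norm Omega u ^+ 2 = vH1_ip u u.
Proof.
move=> Hu; rewrite /vH1norm sqr_sqrtr; last by apply: sumr_ge0 => i _; rewrite sqr_ge0.
by apply: eq_bigr => i _; rewrite H1normE.
Qed.

Variable S : set 'rV[R]_d.
Hypothesis mS : measurable (S : set (surfaceT R d)).

Lemma vH1_0_subspace : is_subspace (vH1_0 Omega S).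
Proof.
have subH := H1_0_subspace openO bddO mS.
by split=> [i|r u v Hu Hv i]; [exact: subH.1|exact: (subH.2 r)].
Qed.

Lemma vH1_0_vH1 : vH1_0 Omega S `<=` vH1 Omega.
Proof. by move=> u Hu i; have [] := Hu i. Qed.

Lemma vH1_0_complete : complete_for vH1_ip (vH1_0 Omega S).
Proof.
move=> x Hx cauchyx.
have HB m n : vH1 Omega (x m - x n).
  by apply: (subspaceB vH1_subspace); exact/vH1_0_vH1.
have /choice[y yP] i : exists y, H1_0 Omega S y /\ forall e, 0 < e ->
    exists N, forall n, (N <= n)%N -> H1_ip Omega (x n i - y) (x n i - y) < e.
  have [||y Hy xy] := H1_0_complete openO bddO (S := S) (x := fun n => x n i).
  - by move=> n; exact: Hx.
  - move=> e /cauchyx[N HN]; exists N => m n Nm Nn.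
    exact: le_lt_trans (vH1_ip_ge i (HB m n)) (HN m n Nm Nn).
  - by exists y.
exists y; first by move=> i; have [] := yP i.
(* Dividing by [d.+1] keeps the sum of [d] shares strictly below [e]. *)
move=> e e0; pose e' := e / d.+1%:R.
have e'0 : 0 < e' by rewrite divr_gt0.
have /choice[N HN] i : exists N, forall n, (N <= n)%N ->
    H1_ip Omega (x n i - y i) (x n i - y i) < e' by have [_] := yP i; exact.
exists (\sum_i N i)%N => n Nn.
apply: (@le_lt_trans _ _ (\sum_(i < d) e')).
  apply: ler_sum => i _; apply/ltW/HN; rewrite (leq_trans _ Nn)//.
  by rewrite (bigD1 i)//= leq_addr.
rewrite sumr_const card_ord -[_ *+ d]mulr_natr /e' mulrAC ltr_pdivrMr//.
by rewrite ltr_pM2l// ltr_nat.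
Qed.

End vector_fields.

Section forms.
Context {R : realType} {d : nat}.
Variable Omega : set 'rV[R]_d.
Hypotheses (openO : open Omega) (bddO : bounded_set Omega).
Variables tau iota alpha : R.
Hypotheses (tau_gt0 : 0 < tau) (iota_gt0 : 0 < iota) (alpha_gt0 : 0 < alpha).

Local Notation mu := (dx R d).
Local Notation ip := (L2_ip mu Omega).
Local Notation scalar := ('rV[R]_d -> R^o).
Let mO := measurable_domain openO.
Let ip_semi_inner := L2_ip_semi_inner mu mO : semi_inner (L2 mu Omega : set scalar) ip.
Let subL2 := L2_subspace mu mO : is_subspace (L2 mu Omega : set scalar).

Lemma strain_L2 u i j : vH1 Omega u -> L2 mu Omega (strain u i j).
Proof.
move=> Hu; apply: (L2Z mO); apply: (L2D mO).
  by have [_ /(_ j)[]] := Hu i.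
by have [_ /(_ i)[]] := Hu j.
Qed.

Lemma divergence_L2 u : vH1 Omega u -> L2 mu Omega (divergence u).
Proof. by move=> Hu; apply: (L2_sum mO) => i; have [_ /(_ i)[]] := Hu i. Qed.

Lemma strain_linear i j (r : R) (u v : vjet R d) :
  (strain (r *: u + v) i j : scalar) = r *: (strain u i j : scalar) + strain v i j.
Proof.
apply/funext => x; rewrite /strain.
change (2^-1 * ((r * (u i).2 j x + (v i).2 j x) + (r * (u j).2 i x + (v j).2 i x)) =
  r * (2^-1 * ((u i).2 j x + (u j).2 i x)) + 2^-1 * ((v i).2 j x + (v j).2 i x)).
by ring.
Qed.

Lemma divergence_linear (r : R) (u v : vjet R d) :
  (divergence (r *: u + v) : scalar) = r *: (divergence u : scalar) + divergence v.
Proof.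
apply/funext => x; rewrite /divergence.
change (\sum_(i < d) (r * (u i).2 i x + (v i).2 i x) =
  r * (\sum_(i < d) (u i).2 i x) + \sum_(i < d) (v i).2 i x).
by rewrite big_split/= mulr_sumr.
Qed.

Let form_aE u v : vH1 Omega u -> vH1 Omega v -> form_a Omega tau iota u v =
  2 * tau * (\sum_(i < d) \sum_(j < d) ip (strain u i j) (strain v i j)) +
  iota * ip (divergence u) (divergence v).
Proof.
move=> Hu Hv; rewrite /form_a; congr (2 * tau * _ + _).
have intuv i j : mu.-integrable Omega (EFin \o (fun x => strain u i j x * strain v i j x)).
  by apply: (L2M_integrable mO); exact: strain_L2.
rewrite (Rintegral_sum mO); last by move=> i; exact: (integrable_Rsum mO).
by apply: eq_bigr => i _; rewrite (Rintegral_sum mO).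
Qed.

Lemma form_a_semi_inner : semi_inner (vH1 Omega) (form_a Omega tau iota).
Proof.
apply: (eq_semi_inner (vH1_subspace openO bddO) form_aE).
apply: semi_innerD; apply: semi_innerZ.
- by rewrite mulr_ge0// ltW.
- apply: semi_inner_sum => i; apply: semi_inner_sum => j.
  apply: (semi_inner_comp (f := fun u => strain u i j) _ _ ip_semi_inner).
  + by move=> u; exact: strain_L2.
  + by move=> r u v; exact: strain_linear.
- exact: ltW.
- apply: (semi_inner_comp (f := divergence) _ _ ip_semi_inner).
  + by move=> u; exact: divergence_L2.
  + by move=> r u v; exact: divergence_linear.
Qed.

Let partial_le u i j : vH1 Omega u -> ip ((u i).2 j) ((u i).2 j) <= vH1_ip Omega u u.
Proof.
move=> Hu; apply: le_trans (H1_ip_ge2 openO j (Hu i)) _.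
exact: vH1_ip_ge.
Qed.

(** Each of the $d^2$ strain entries is a mean of two partial derivatives, and the squared norm of a
    sum of [d] terms is at most $d^2$ times the largest one. *)
Lemma form_a_le u : vH1 Omega u ->
  form_a Omega tau iota u u <= (2 * tau + iota) * d%:R ^+ 2 * vH1_ip Omega u u.
Proof.
move=> Hu; rewrite form_aE// -[leRHS]mulrA [leRHS]mulrDl; apply: lerD.
  rewrite ler_pM2l ?mulr_gt0//.
  apply: (@le_trans _ _ (\sum_(i < d) \sum_(j < d) vH1_ip Omega u u)); last first.
    by rewrite !sumr_const !card_ord -mulrnA -[leLHS]mulr_natl natrM expr2.
  apply: ler_sum => i _; apply: ler_sum => j _.
  have Li : L2 mu Omega ((u i).2 j) by have [_ /(_ j)[]] := Hu i.
  have Lj : L2 mu Omega ((u j).2 i) by have [_ /(_ i)[]] := Hu j.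
  have LD := subspaceD subL2 Li Lj.
  rewrite (_ : strain u i j = 2^-1 *: ((u i).2 j + (u j).2 i : scalar))//.
  rewrite (linear_onZ subL2 (semi_inner_linl ip_semi_inner _))//; last exact: subspaceZ.
  rewrite (linear_onZ subL2 (semi_inner_linr subL2 ip_semi_inner _))//.
  have -> : (u i).2 j + (u j).2 i = (u i).2 j + 1 *: ((u j).2 i : scalar).
    by rewrite scale1r.
  rewrite (semi_inner_sqrD subL2 ip_semi_inner)//.
  have := semi_inner_le_mean subL2 ip_semi_inner Li Lj.
  have := partial_le i j Hu; have := partial_le j i Hu; rewrite expr1n; lra.
rewrite ler_pM2l//.
rewrite (_ : divergence u = \sum_(i < d) ((u i).2 i : scalar)); last first.
  by apply/funext => x; rewrite fct_sumE.
apply: le_trans (semi_inner_sum_le subL2 ip_semi_inner (M := vH1_ip Omega u u) _ _) _.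
- by move=> i; have [_ /(_ i)[]] := Hu i.
- by move=> i; exact: partial_le.
- by rewrite card_ord.
Qed.

Variable kappa : 'rV[R]_d -> 'M[R]_d.
Hypothesis kappaP : admissible_kappa Omega kappa.

Definition flux (p : jet R d) (i : 'I_d) : 'rV[R]_d -> R :=
  fun x => \sum_(j < d) kappa x i j * p.2 j x.

Lemma flux_L2 p i : H1 Omega p -> L2 mu Omega (flux p i).
Proof.
move=> [_ Hp]; have [mk [M kM] _ _] := kappaP.
apply: (L2_sum mO) => j; apply: (L2_bounded_mul mO (M := M) (mk i j)).
  by move: kM; apply: ae_imply => x kx /kx.
by have [] := Hp j.
Qed.

Lemma flux_linear i (r : R) (p q : jet R d) :
  (flux (r *: p + q) i : scalar) = r *: (flux p i : scalar) + flux q i.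
Proof.
apply/funext => x; rewrite /flux.
change (\sum_(j < d) kappa x i j * (r * p.2 j x + q.2 j x) =
  r * (\sum_(j < d) kappa x i j * p.2 j x) + \sum_(j < d) kappa x i j * q.2 j x).
by rewrite mulr_sumr -big_split; apply: eq_bigr => j _ /=; ring.
Qed.

Let integrable_flux p q : H1 Omega p -> H1 Omega q ->
  mu.-integrable Omega (EFin \o (fun x => \sum_(i < d) flux p i x * q.2 i x)).
Proof.
move=> Hp [_ Hq]; apply: (integrable_Rsum mO) => i.
by apply: (L2M_integrable mO); [exact: flux_L2|have [] := Hq i].
Qed.

Let form_cE p q : H1 Omega p -> H1 Omega q -> form_c Omega iota alpha kappa p q =
  alpha ^+ 2 / iota * ip p.1 q.1 + \sum_(i < d) ip (flux p i) (q.2 i).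
Proof.
move=> Hp [_ Hq]; rewrite /form_c; congr (_ + _); rewrite (Rintegral_sum mO)// => i.
by apply: (L2M_integrable mO); [exact: flux_L2|have [] := Hq i].
Qed.

Let integrable_sqr p (k : R) : H1 Omega p ->
  mu.-integrable Omega (EFin \o (fun x => \sum_(i < d) k * (p.2 i x * p.2 i x))).
Proof.
move=> [_ Hp]; apply: (integrable_Rsum mO) => i.
have Li : L2 mu Omega (p.2 i) by have [] := Hp i.
have := integrableZl mO k (L2M_integrable mO Li Li).
by apply: eq_integrable.
Qed.

Let Rintegral_sqr p (k : R) : H1 Omega p ->
  \int[mu]_(x in Omega) (\sum_(i < d) k * (p.2 i x * p.2 i x)) =
  k * \sum_(i < d) ip (p.2 i) (p.2 i).
Proof.
move=> [_ Hp]; have Li i : L2 mu Omega (p.2 i) by have [] := Hp i.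
rewrite (Rintegral_sum mO) => [|i].
  rewrite mulr_sumr; apply: eq_bigr => i _; rewrite RintegralZl//.
  exact: (L2M_integrable mO).
have := integrableZl mO k (L2M_integrable mO (Li i) (Li i)).
by apply: eq_integrable.
Qed.

Let flux_ge : exists2 k0 : R, 0 < k0 & forall p, H1 Omega p ->
  k0 * \sum_(i < d) ip (p.2 i) (p.2 i) <=
  \int[mu]_(x in Omega) (\sum_(i < d) flux p i x * p.2 i x).
Proof.
have [_ _ _ [k0 k0_gt0 kpos]] := kappaP; exists k0 => // p Hp.
rewrite -Rintegral_sqr//; apply: (ae_le_Rintegral mO).
- exact: integrable_sqr.
- exact: integrable_flux.
move: kpos; apply: ae_imply => x kx Ox.
(* Uniform positivity is tested with the weak gradient at [x]. *)
have := kx Ox (\row_i p.2 i x).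
rewrite /enorm sqr_sqrtr; last by apply: sumr_ge0 => i _; rewrite -expr2 sqr_ge0.
rewrite /dotp mulr_sumr => h; apply: le_trans (le_trans _ h) _.
  by apply: ler_sum => i _; rewrite !mxE.
under eq_bigr do rewrite !mxE mulr_suml.
rewrite exchange_big /=; apply: ler_sum => i _; rewrite mulr_suml.
by apply: ler_sum => j _; rewrite !mxE; lra.
Qed.

Let ip_partial_ge0 p : H1 Omega p -> 0 <= \sum_(i < d) ip (p.2 i) (p.2 i).
Proof.
move=> [_ Hp]; apply: sumr_ge0 => i _.
by apply: (semi_inner_ge0 ip_semi_inner); have [] := Hp i.
Qed.

Lemma form_c_ge : exists2 c : R, 0 < c &
  forall p, H1 Omega p -> c * H1_ip Omega p p <= form_c Omega iota alpha kappa p p.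
Proof.
have [k0 k0_gt0 k0P] := flux_ge.
exists (Num.min (alpha ^+ 2 / iota) k0); first by rewrite lt_min k0_gt0 divr_gt0// exprn_gt0.
move=> p Hp; have [Lp _] := Hp; rewrite /H1_ip mulrDr; apply: lerD.
  by rewrite ler_wpM2r ?ge_min ?lexx//; exact: (semi_inner_ge0 ip_semi_inner).
by apply: le_trans (k0P p Hp); rewrite ler_wpM2r ?ip_partial_ge0// ge_min lexx orbT.
Qed.

Lemma form_c_le : exists2 C : R, 0 < C &
  forall p, H1 Omega p -> form_c Omega iota alpha kappa p p <= C * H1_ip Omega p p.
Proof.
have [_ [M kM] _ _] := kappaP; pose C := alpha ^+ 2 / iota + 2 * d%:R * `|M|.
have C1 : alpha ^+ 2 / iota <= C by rewrite lerDl !mulr_ge0.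
have ai : 0 < alpha ^+ 2 / iota by rewrite divr_gt0// exprn_gt0.
have C2 : 2 * d%:R * `|M| <= C by rewrite lerDr ltW.
exists C; first exact: lt_le_trans ai C1.
move=> p Hp; have [Lp Lp2] := Hp; rewrite /H1_ip mulrDr; apply: lerD.
  by rewrite ler_wpM2r//; exact: (semi_inner_ge0 ip_semi_inner).
apply: (@le_trans _ _ (2 * d%:R * `|M| * \sum_(i < d) ip (p.2 i) (p.2 i))); last first.
  by rewrite ler_wpM2r// ip_partial_ge0.
rewrite -Rintegral_sqr//; apply: (ae_le_Rintegral mO).
- exact: integrable_flux.
- exact: integrable_sqr.
move: kM; apply: ae_imply => x kx /kx {}kx.
(* Young's inequality entrywise; the double sum counts each square $2d$ times, whence the constant
   [C]. *)
apply: (@le_trans _ _ (\sum_(i < d) \sum_(j < d)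
    (`|M| * (p.2 j x * p.2 j x) + `|M| * (p.2 i x * p.2 i x)))).
  apply: ler_sum => i _; rewrite mulr_suml; apply: ler_sum => j _.
  have {}kx := kx i j; apply: le_trans (ler_norm _) _; rewrite !normrM -mulrDr -mulrA.
  apply: ler_pM => //; first exact: le_trans kx (ler_norm _).
  have := sqr_ge0 (`|p.2 j x| - `|p.2 i x|).
  have := real_normK (num_real (p.2 j x)); have := real_normK (num_real (p.2 i x)).
  rewrite -!expr2 => <- <-; set a := `|_|; set b := `|_|; nra.
under eq_bigr do rewrite big_split/= sumr_const card_ord.
rewrite big_split/= sumr_const card_ord -sumrMnl -big_split/=.
apply: ler_sum => i _; rewrite -[_ *+ d]mulr_natr; lra.
Qed.

Lemma form_c_semi_inner : semi_inner (H1 Omega) (form_c Omega iota alpha kappa).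
Proof.
split.
- move=> w Hw r u v Hu Hv; have Hruv := (H1_subspace openO bddO).2 r _ _ Hu Hv.
  have [Lw Lw2] := Hw; have [Lu _] := Hu; have [Lv _] := Hv.
  rewrite !form_cE//.
  have -> : ip (r *: u + v).1 w.1 = r * ip u.1 w.1 + ip v.1 w.1.
    exact: (semi_inner_linl ip_semi_inner Lw r Lu Lv).
  have -> : \sum_(i < d) ip (flux (r *: u + v) i) (w.2 i) =
      r * (\sum_(i < d) ip (flux u i) (w.2 i)) + \sum_(i < d) ip (flux v i) (w.2 i).
    rewrite mulr_sumr -big_split; apply: eq_bigr => i _ /=; rewrite flux_linear.
    by rewrite (semi_inner_linl ip_semi_inner)//; [have [] := Lw2 i|exact: flux_L2..].
  by ring.
- move=> u v Hu Hv; rewrite /form_c; congr (_ * _ + _).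
    by apply: eq_Rintegral => x _; rewrite mulrC.
  have [_ _ ksym _] := kappaP.
  apply: (ae_eq_Rintegral mO); [exact: integrable_flux|exact: integrable_flux|].
  move: ksym; apply: ae_imply => x /[apply] ksym.
  under eq_bigr do rewrite mulr_suml.
  rewrite exchange_big; apply: eq_bigr => i _ /=; rewrite mulr_suml.
  by apply: eq_bigr => j _; rewrite -[in kappa x j i]ksym mxE; ring.
- move=> u Hu; have [c c0 hc] := form_c_ge; apply: le_trans (hc _ Hu).
  by apply: mulr_ge0; [exact: ltW|exact: (semi_inner_ge0 (H1_ip_semi_inner openO))].
Qed.

Lemma form_b_linl q : H1 Omega q -> linear_on (vH1 Omega) ((form_b Omega alpha)^~ q).
Proof.
move=> [Lq _] r u v Hu Hv; rewrite /form_b.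
have := semi_inner_linl ip_semi_inner Lq r (divergence_L2 Hu) (divergence_L2 Hv).
by rewrite -divergence_linear /L2_ip => ->; ring.
Qed.

Lemma form_b_linr u : vH1 Omega u -> linear_on (H1 Omega) (form_b Omega alpha u).
Proof.
move=> Hu r p q [Lp _] [Lq _]; rewrite /form_b.
have := semi_inner_linr subL2 ip_semi_inner (divergence_L2 Hu) r Lp Lq.
by rewrite /L2_ip /= => ->; ring.
Qed.

(** Cauchy-Schwarz for the divergence and the pressure, with $\alpha^2=\iota\cdot\alpha^2/\iota$
    shared between the volumetric part of [form_a] and the zero-order part of [form_c]. *)
Lemma form_b_le u q : vH1 Omega u -> H1 Omega q ->
  `|form_b Omega alpha u q| <= Num.sqrt (form_a Omega tau iota u u) *
                               Num.sqrt (form_c Omega iota alpha kappa q q).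
Proof.
move=> Hu Hq; have [Lq Lq2] := Hq; have Ldu := divergence_L2 Hu.
have a0 := semi_inner_ge0 form_a_semi_inner Hu.
have c0 := semi_inner_ge0 form_c_semi_inner Hq.
have dd0 := semi_inner_ge0 ip_semi_inner Ldu.
have qq0 := semi_inner_ge0 ip_semi_inner Lq.
have ale : iota * ip (divergence u) (divergence u) <= form_a Omega tau iota u u.
  rewrite form_aE// lerDr mulr_ge0//; first by rewrite mulr_ge0// ltW.
  apply: sumr_ge0 => i _; apply: sumr_ge0 => j _.
  by apply: (semi_inner_ge0 ip_semi_inner); exact: strain_L2.
have cle : alpha ^+ 2 / iota * ip q.1 q.1 <= form_c Omega iota alpha kappa q q.
  have [k0 k0_gt0 k0P] := flux_ge; rewrite lerDl; apply: le_trans (k0P q Hq).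
  by rewrite mulr_ge0 ?ip_partial_ge0// ltW.
rewrite -sqrtrM// -sqrtr_sqr ler_wsqrtr// exprMn.
apply: le_trans (ler_pM _ _ ale cle).
- rewrite (_ : iota * _ * _ = alpha ^+ 2 *
      (ip (divergence u) (divergence u) * ip q.1 q.1)); last by field; rewrite gt_eqF.
  rewrite ler_wpM2l ?sqr_ge0//.
  exact: (semi_inner_cauchy_schwarz subL2 ip_semi_inner Ldu Lq).
- by rewrite mulr_ge0// ltW.
- by rewrite mulr_ge0// ltW// divr_gt0// exprn_gt0.
Qed.

End forms.

(** * The contact constraint *)

Section obstacle.
Context {disp : measure_display} {T : measurableType disp} {R : realType}.
Context {E : lmodType R}.
Variables (mu : {measure set T -> \bar R}) (D : set T) (W : set E).
Variables (gamma : E -> T -> R) (a : E -> E -> R) (C : R).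
Hypotheses (mD : measurable D) (subW : is_subspace W).
Hypothesis gamma_linear : forall (r : R) u v, W u -> W v ->
  {ae mu, forall x, D x -> gamma (r *: u + v) x = r * gamma u x + gamma v x}.
Hypothesis C_gt0 : 0 < C.
Hypothesis gamma_L2 : forall v, W v -> L2 mu D (gamma v).
Hypothesis gamma_le : forall v, W v -> L2_ip mu D (gamma v) (gamma v) <= C * a v v.

Definition obstacle (g : T -> R) : set E :=
  [set v | W v /\ {ae mu, forall x, D x -> gamma v x <= g x}].

Lemma obstacleB u v : W u -> W v ->
  {ae mu, forall x, D x -> gamma (u - v) x = gamma u x - gamma v x}.
Proof.
move=> Wu Wv; have := gamma_linear (-1) Wv Wu.
rewrite scaleN1r addrC; apply: ae_imply => x h Dx.
by rewrite h// mulN1r addrC.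
Qed.

Lemma obstacleD u v : W u -> W v ->
  {ae mu, forall x, D x -> gamma (u + v) x = gamma u x + gamma v x}.
Proof.
move=> Wu Wv; have := gamma_linear 1 Wu Wv.
by rewrite scale1r; apply: ae_imply => x h Dx; rewrite h// mul1r.
Qed.

Lemma obstacle_convex g u v (t : R) : obstacle g u -> obstacle g v -> 0 <= t <= 1 ->
  obstacle g (u + t *: (v - u)).
Proof.
move=> [Wu gu] [Wv gv] /andP[t0 t1]; have Wvu := subspaceB subW Wv Wu.
split; first by apply: (subspaceD subW Wu); exact: (subspaceZ subW).
have lin : {ae mu, forall x, D x ->
    gamma (t *: (v - u) + u) x = t * (gamma v x - gamma u x) + gamma u x}.
  apply: ae_imply2 (gamma_linear t Wvu Wu) (obstacleB Wv Wu) => x h1 h2 Dx.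
  by rewrite h1// h2.
have guv := ae_imply2 (fun x => @conj _ _) gu gv.
rewrite addrC; apply: ae_imply2 lin guv => x linx [gux gvx] Dx.
have := gux Dx; have := gvx Dx; rewrite linx//.
by move: (gamma u x) (gamma v x) (g x) => p q r h1 h2; nra.
Qed.

(* A limit violating the constraint by more than [e] on a set forces
   [gamma (x n - y)] to exceed [e] there for every [n]; by Chebyshev's
   inequality such a set is null. *)
Lemma obstacle_complete g : complete_for a W -> complete_for a (obstacle g).
Proof.
move=> compW x Kx cauchyx.
have Wx n : W (x n) by have [] := Kx n.
have [y Wy xy] := compW x Wx cauchyx; exists y => //; split => //.
have Wd n : W (x n - y) by exact: (subspaceB subW).
pose w n := gamma (x n - y).
have Lw n : L2 mu D (w n) by exact: gamma_L2.
pose big e n : set T := D `&` [set z | (e <= `|w n z|)%R].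
have mbig e n : measurable (big e n).
  rewrite /big (_ : [set z | _] = [set z | (e%:E <= `|(w n z)%:E|)%E])//.
  apply: emeasurable_fun_c_infty => //; apply: measurableT_comp => //.
  exact/measurable_EFinP/(L2_measurable (Lw n)).
(* The intersection lies in every [big c N], whose measure is at most $C\,a(x_N-y,x_N-y)/c^2$. *)
have null c : 0 < c -> mu (\bigcap_n big c n) = 0%E.
  move=> c0; apply/eqP; rewrite eq_le measure_ge0 andbT.
  apply/lee_addgt0Pr => e e0; rewrite add0e.
  have c2 : 0 < c ^+ 2 by rewrite exprn_gt0.
  have [|N /(_ N (leqnn N)) HN] := xy (e * c ^+ 2 / C).
    by rewrite divr_gt0// mulr_gt0.
  apply: (@le_trans _ _ (mu (big c N))).
    by apply: le_measure; rewrite ?inE//; [exact: bigcapT_measurable|exact: bigcap_inf].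
  have wN : L2_ip mu D (w N) (w N) <= c ^+ 2 * e.
    apply: le_trans (gamma_le (Wd N)) _; rewrite mulrC -ler_pdivlMr// ltW//.
    by rewrite (mulrC (c ^+ 2)).
  rewrite -(@lee_pmul2l _ (c ^+ 2)%:E) ?lte_fin//.
  by apply: le_trans (L2_chebyshev mD c0 (Lw N)) _; rewrite -EFinM lee_fin.
have good : {ae mu, forall z, forall k, ~ (\bigcap_n big k.+1%:R^-1 n) z}.
  apply: ae_foralln => k.
  have : mu.-negligible (\bigcap_n big k.+1%:R^-1 n).
    apply/negligibleP; first exact: bigcapT_measurable.
    by apply: null; rewrite invr_gt0.
  by apply: negligibleS => z /= /contrapT.
have lin : {ae mu, forall z, forall n, D z ->
    gamma (x n) z <= g z /\ w n z = gamma (x n) z - gamma y z}.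
  apply: ae_foralln => n; have [_ gn] := Kx n.
  by apply: ae_imply2 gn (obstacleB (Wx n) Wy) => z gz wz Dz; split; [exact: gz|exact: wz].
(* As $\gamma x_n\le g$ at [z] for all [n], a gap $\gamma y-g>1/(k+1)$ would put [z] in every
   [big k.+1%:R^-1 n]. *)
apply: ae_imply2 good lin => z zbig zlin Dz; rewrite leNgt; apply/negP => gy.
have e0 : 0 < gamma y z - g z by rewrite subr_gt0.
have [k _ hk] := near_infty_natSinv_lt (PosNum e0).
apply: (zbig k) => n _; split => //=; have [xg ->] := zlin n Dz.
have := hk k (leqnn k) => /= /ltW /le_trans; apply.
by rewrite -normrN (le_trans _ (ler_norm _))//; move: xg; lra.
Qed.

Context {F : lmodType R}.
Variables (V : set F) (b : E -> F -> R) (c : F -> F -> R).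
Hypothesis subV : is_subspace V.
Hypotheses (aP : semi_inner W a) (cP : semi_inner V c).
Hypotheses (blinl : forall q, V q -> linear_on W (b^~ q))
           (blinr : forall u, W u -> linear_on V (b u)).
Hypothesis b_le : forall u q, W u -> V q ->
  `|b u q| <= Num.sqrt (a u u) * Num.sqrt (c q q).

Local Notation norma := (fun u => Num.sqrt (a u u)).
Local Notation normc := (fun q => Num.sqrt (c q q)).

Lemma obstacle_saddle_point_exists fe ff g :
  complete_for a W -> complete_for c V -> dual W norma fe -> dual V normc ff ->
  obstacle g !=set0 -> exists u p, saddle_point V a b c (obstacle g) fe ff u p.
Proof.
move=> compW compV [lfe [Ce feC]] [lff [Cf ffC]] K0.
apply: (saddle_point_exists subW subV aP cP blinl blinr b_le compV
  (obstacle_complete compW) _ K0 _ lfe feC lff ffC); first by move=> u [].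
by move=> u v t; exact: obstacle_convex.
Qed.

Lemma obstacle_saddle_point_lipschitz fe fe' ff ff' g g' u u' p p' w :
  dual W norma fe -> dual W norma fe' -> dual V normc ff -> dual V normc ff' ->
  saddle_point V a b c (obstacle g) fe ff u p ->
  saddle_point V a b c (obstacle g') fe' ff' u' p' ->
  W w -> {ae mu, forall x, D x -> gamma w x = g x - g' x} ->
  Num.sqrt (norma (u - u') ^+ 2 + normc (p - p') ^+ 2) <=
    dual_norm W norma (fun v => fe v - fe' v) +
    dual_norm V normc (fun q => ff q - ff' q) + 3 * norma w.
Proof.
move=> dfe dfe' dff dff' sol sol' Ww gw.
have dF := dualB dfe dfe'; have dG := dualB dff dff'.
have [lfe _] := dfe; have [lfe' _] := dfe'; have [lff _] := dff; have [lff' _] := dff'.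
have [[Wu gu] _ _ _] := sol; have [[Wu' gu'] _ _ _] := sol'.
apply: (saddle_point_stable subW subV aP cP blinl blinr b_le Wu Wu' Ww _ _ _ _
  lfe lfe' lff lff' _ _ sol sol').
- split; first exact: (subspaceD subW).
  have gww := ae_imply2 (fun x => @conj _ _) gw (obstacleD Wu' Ww).
  apply: ae_imply2 gu' gww => x gux [gwx lx] Dx.
  by have := gux Dx; rewrite lx// gwx//; lra.
- split; first exact: (subspaceB subW).
  have gww := ae_imply2 (fun x => @conj _ _) gw (obstacleB Wu Ww).
  apply: ae_imply2 gu gww => x gux [gwx lx] Dx.
  by have := gux Dx; rewrite lx// gwx//; lra.
- exact: (dual_norm_ge0 subW aP dF).
- exact: (dual_norm_ge0 subV cP dG).
- by move=> v Wv; exact: (dual_norm_le subW aP dF Wv).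
- by move=> q Vq; exact: (dual_norm_le subV cP dG Vq).
Qed.

(** The stability estimate with equal data and lifting [0]. *)
Lemma obstacle_saddle_point_unique fe ff g u u' p p' :
  linear_on W fe -> linear_on V ff ->
  saddle_point V a b c (obstacle g) fe ff u p ->
  saddle_point V a b c (obstacle g) fe ff u' p' ->
  a (u - u') (u - u') <= 0 /\ c (p - p') (p - p') <= 0.
Proof.
move=> lfe lff sol sol'.
have [Ku Vp _ _] := sol; have [Ku' Vp' _ _] := sol'; have [Wu _] := Ku; have [Wu' _] := Ku'.
have Ku0 : obstacle g (u' + 0) by rewrite addr0.
have Ku'0 : obstacle g (u - 0) by rewrite subr0.
have zero (G : lmodType R) (X : set G) (l N : G -> R) v : X v -> `|l v - l v| <= 0 * N v.
  by rewrite subrr normr0 mul0r.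
have := saddle_point_stable subW subV aP cP blinl blinr b_le Wu Wu' subW.1 Ku0 Ku'0
  (lexx 0) (lexx 0) lfe lfe lff lff (zero _ _ _ _) (zero _ _ _ _) sol sol'.
rewrite (linear_on0 subW (semi_inner_linl aP subW.1)) sqrtr0 mulr0 !addr0.
have ae0 := semi_inner_ge0 aP (subspaceB subW Wu Wu').
have cr0 := semi_inner_ge0 cP (subspaceB subV Vp Vp').
rewrite !sqr_sqrtr// -[leRHS]sqrtr0 ler_sqrt// => ac0.
by split; apply: le_trans ac0; rewrite ?lerDl ?lerDr.
Qed.

Lemma obstacle_saddle_point_lipschitz_inf fe fe' ff ff' g g' u u' p p' :
  dual W norma fe -> dual W norma fe' -> dual V normc ff -> dual V normc ff' ->
  saddle_point V a b c (obstacle g) fe ff u p ->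
  saddle_point V a b c (obstacle g') fe' ff' u' p' ->
  (exists2 w, W w & gamma w = g %[ae mu in D]) ->
  (exists2 w, W w & gamma w = g' %[ae mu in D]) ->
  Num.sqrt (norma (u - u') ^+ 2 + normc (p - p') ^+ 2) <=
    dual_norm W norma (fun v => fe v - fe' v) +
    dual_norm V normc (fun q => ff q - ff' q) +
    3 * inf [set norma w | w in
      [set w | W w /\ gamma w = (fun x => g x - g' x) %[ae mu in D]]].
Proof.
move=> dfe dfe' dff dff' sol sol' [w1 Ww1 gw1] [w2 Ww2 gw2].
rewrite -lerBlDl -ler_pdivrMl//; apply: lb_le_inf.
  (* The infimum needs a nonempty set: the difference of liftings of [g] and [g'] lifts [g - g']. *)
  exists (norma (w1 - w2)), (w1 - w2) => //; split; first exact: (subspaceB subW).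
  have gww := ae_imply2 (fun x => @conj _ _) gw1 gw2.
  apply: ae_imply2 gww (obstacleB Ww1 Ww2) => x [h1 h2] h Dx.
  by rewrite h// h1// h2.
move=> _ [w [Ww gw] <-]; rewrite ler_pdivrMl// lerBlDl.
exact: (obstacle_saddle_point_lipschitz dfe dfe' dff dff' sol sol' Ww gw).
Qed.

End obstacle.

(** * From the $H^{1/2}$ norm to $L^2$, and from zero energy to equality *)

Section trace_bounds.
Context {R : realType} {d : nat}.
Variables (Omega Gamma_c : set 'rV[R]_d).
Local Notation sigma := (surf R d).

Let integral_sqr_le_Hhalf g :
  (\int[sigma]_(x in Gamma_c) ((g x) ^+ 2)%:E <= sqHhalf Gamma_c g)%E.
Proof.
rewrite /sqHhalf leeDl//; apply: integral_ge0 => x _; apply: integral_ge0 => y _.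
by rewrite lee_fin divr_ge0 ?sqr_ge0// exprn_ge0// sqrtr_ge0.
Qed.

Lemma Hhalf_L2 g : Hhalf Gamma_c g -> L2 sigma Gamma_c g.
Proof. by move=> [mg gy]; split => //; exact: le_lt_trans gy. Qed.

Lemma L2_ip_le_Hhalf g : Hhalf Gamma_c g ->
  L2_ip sigma Gamma_c g g <= Hhalf_norm Gamma_c g ^+ 2.
Proof.
move=> Hg; have Lg := Hhalf_L2 Hg; have [_ gy] := Hg.
have le_sq := integral_sqr_le_Hhalf g.
have sq_ge0 : (0 <= sqHhalf Gamma_c g)%E.
  by apply: le_trans le_sq; apply: integral_ge0 => x _; rewrite lee_fin sqr_ge0.
rewrite /Hhalf_norm sqr_sqrtr ?fine_ge0// -lee_fin L2_ipE//.
by rewrite fineK// ge0_fin_numE.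
Qed.

Hypothesis openO : open Omega.

Lemma H1_ip_eq0 (p q : jet R d) : H1 Omega (p - q) ->
  H1_ip Omega (p - q) (p - q) <= 0 -> eq_H1 Omega p q.
Proof.
move=> Hpq pq0; have mO := measurable_domain openO.
have [Lpq _] := Hpq; have ip_ge0 := semi_inner_ge0 (L2_ip_semi_inner (dx R d) mO) Lpq.
have ip0 : L2_ip (dx R d) Omega (p - q).1 (p - q).1 = 0.
  by apply/eqP; rewrite eq_le ip_ge0 andbT (le_trans (H1_ip_ge1 openO Hpq)).
have := L2_ip_eq0 mO Lpq ip0; apply: ae_imply => x pqx Ox.
by apply/eqP; rewrite -subr_eq0; apply/eqP; exact: pqx.
Qed.

End trace_bounds.

Theorem theorem3p3 (R : realType) (d : nat) (d23 : d = 2%N \/ d = 3%N)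
  (Omega : set 'rV[R]_d) (domOmega : lipschitz_domain Omega)
  (Gamma_p Gamma_f Gamma_c Gamma_d Gamma_t : set 'rV[R]_d)
  (decpf : decomposition2 Omega Gamma_p Gamma_f)
  (deccdt : decomposition3 Omega Gamma_c Gamma_d Gamma_t)
  (Gamma_p_gt0 : (0 < surf R d Gamma_p)%E)
  (Gamma_d_gt0 : (0 < surf R d Gamma_d)%E)
  (Gamma_dc : closure Gamma_d `&` closure Gamma_c = set0)
  (tau iota alpha : R) (tau_gt0 : 0 < tau) (iota_gt0 : 0 < iota)
  (alpha_gt0 : 0 < alpha)
  (kappa : 'rV[R]_d -> 'M[R]_d) (kappaP : admissible_kappa Omega kappa)
  (korn : korn_inequality Omega tau iota Gamma_d)
  (gammaP : normal_trace_bounded_onto Omega tau iota Gamma_d Gamma_c) :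
  let data := admissible_data Omega tau iota alpha kappa
                Gamma_d Gamma_c Gamma_p in
  let solution := is_solution Omega tau iota alpha kappa
                    Gamma_d Gamma_c Gamma_p in
  let norm_u := norm_u Omega tau iota in
  let norm_p := norm_p Omega iota alpha kappa in
  (forall (fe : vjet R d -> R) (ff : jet R d -> R) (g : 'rV[R]_d -> R),
    data fe ff g ->
    exists (u : vjet R d) (p : jet R d),
      solution fe ff g u p /\
      forall (u' : vjet R d) (p' : jet R d), solution fe ff g u' p' ->
        eq_vH1 Omega u u' /\ eq_H1 Omega p p') /\
  (forall (fe fe' : vjet R d -> R) (ff ff' : jet R d -> R)
          (g g' : 'rV[R]_d -> R)
          (u u' : vjet R d) (p p' : jet R d),
    data fe ff g -> data fe' ff' g' ->
    solution fe ff g u p -> solution fe' ff' g' u' p' ->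
    Num.sqrt (norm_u (u - u') ^+ 2 + norm_p (p - p') ^+ 2) <=
      dual_norm (vH1_0 Omega Gamma_d) norm_u (fun v => fe v - fe' v) +
      dual_norm (H1_0 Omega Gamma_p) norm_p (fun q => ff q - ff' q) +
      3 * normal_trace_norm Omega tau iota Gamma_d Gamma_c
            (fun x => g x - g' x)).
Proof.
move=> data solution nu np.
have [openO _ _ bddO _] := domOmega.
have [mGp _ _ _] := decpf; have [mGc mGd _ _ _] := deccdt.
have d0 : (0 < d)%N by case: d23 => ->.
pose a := form_a Omega tau iota; pose b := form_b Omega alpha.
pose c := form_c Omega iota alpha kappa.
pose U := vH1_0 Omega Gamma_d; pose V := H1_0 Omega Gamma_p.
pose gamma := normal_trace Omega Gamma_c.
have subU : is_subspace U := vH1_0_subspace openO bddO mGd.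
have subV : is_subspace V := H1_0_subspace openO bddO mGp.
have UH u : U u -> vH1 Omega u := @vH1_0_vH1 R d Omega Gamma_d u.
have VH q : V q -> H1 Omega q by case.
have aP : semi_inner U a.
  exact: (semi_inner_comp (f := id) UH _ (form_a_semi_inner openO bddO tau_gt0 iota_gt0)).
have cP : semi_inner V c.
  exact: (semi_inner_comp (f := id) VH _
    (form_c_semi_inner openO bddO iota_gt0 alpha_gt0 kappaP)).
have blinl q : V q -> linear_on U (b^~ q).
  by move=> Vq r u v Uu Uv; apply: (form_b_linl openO alpha (VH _ Vq)); exact: UH.
have blinr u : U u -> linear_on V (b u).
  by move=> Uu r p q Vp Vq; apply: (form_b_linr openO alpha (UH _ Uu)); exact: VH.
have b_le u q : U u -> V q -> `|b u q| <= Num.sqrt (a u u) * Num.sqrt (c q q).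
  move=> Uu Vq.
  exact: (form_b_le openO bddO tau_gt0 iota_gt0 alpha_gt0 kappaP (UH _ Uu) (VH _ Vq)).
have [k k_gt0 kornk] := korn.
have a_ge u : U u -> k ^+ 2 * vH1_ip Omega u u <= a u u.
  move=> Uu; rewrite -(vH1normE (UH _ Uu)) -exprMn.
  rewrite -(sqr_sqrtr (semi_inner_ge0 aP Uu)) lerXn2r ?nnegrE ?sqrtr_ge0//.
    by rewrite mulr_ge0 ?sqrtr_ge0// ltW.
  exact: kornk.
have a_le u : U u -> a u u <= (2 * tau + iota) * d%:R ^+ 2 * vH1_ip Omega u u.
  by move=> Uu; apply: form_a_le => //; exact: UH.
have compU : complete_for a U.
  apply: (complete_for_equiv subU _ _ _ a_ge a_le (@vH1_0_complete _ _ _ openO bddO _)) => //.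
    by rewrite exprn_gt0.
  by rewrite mulr_gt0// ?exprn_gt0 ?ltr0n// addr_gt0// mulr_gt0.
have [c1 c1_gt0 c_ge] := form_c_ge openO iota_gt0 alpha_gt0 kappaP.
have [c2 c2_gt0 c_le] := form_c_le openO iota_gt0 alpha_gt0 kappaP.
have compV : complete_for c V.
  apply: (complete_for_equiv subV _ c1_gt0 c2_gt0 (fun q Vq => c_ge q (VH q Vq))
    (fun q Vq => c_le q (VH q Vq)) (@H1_0_complete _ _ _ openO bddO _)) => //.
have [gamma_lin gammaH [C gammaC] gamma_onto] := gammaP.
have gamma_linear (r : R) u v : U u -> U v -> {ae surf R d, forall x, Gamma_c x ->
    gamma (r *: u + v) x = r * gamma u x + gamma v x} := gamma_lin r u v.
have gamma_L2 v : U v -> L2 (surf R d) Gamma_c (gamma v).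
  by move=> Uv; apply: Hhalf_L2; exact: gammaH.
(* The trace constant [C] carries no sign; [C ^+ 2 + 1] is a positive constant for the squared
   bound. *)
have C1 : 0 < C ^+ 2 + 1 by rewrite ltr_wpDl// sqr_ge0.
have gamma_le v : U v -> L2_ip (surf R d) Gamma_c (gamma v) (gamma v) <=
    (C ^+ 2 + 1) * a v v.
  move=> Uv; have a0 := semi_inner_ge0 aP Uv.
  apply: le_trans (L2_ip_le_Hhalf (gammaH v Uv)) _.
  apply: (@le_trans _ _ (C ^+ 2 * a v v)); last by rewrite ler_wpM2r// lerDl.
  have N0 : 0 <= Hhalf_norm Gamma_c (gamma v) by exact: sqrtr_ge0.
  rewrite -(sqr_sqrtr a0) -exprMn lerXn2r ?nnegrE//; last exact: gammaC.
  exact: le_trans (gammaC v Uv).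
(* [noncontact] unfolds to [obstacle] and [is_solution] to [saddle_point], so this holds by
   conversion. *)
have saddle fe ff g u p : solution fe ff g u p ->
    saddle_point V a b c (obstacle (surf R d) Gamma_c U gamma g) fe ff u p by [].
split=> [fe ff g [dfe dff Hg K0]|].
  have [u [p sol]] := obstacle_saddle_point_exists mGc subU gamma_linear C1 gamma_L2
    gamma_le subV aP cP blinl blinr b_le compU compV dfe dff K0.
  exists u, p; split; first exact: sol.
  move=> u' p' sol'.
  have [[[Uu _] Vp _ _] [[Uu' _] Vp' _ _]] := (sol, sol').
  have Ue := subspaceB subU Uu Uu'; have Vr := subspaceB subV Vp Vp'.
  have [a_le0 c_le0] := obstacle_saddle_point_unique subU subV aP cP blinl blinr b_le
    dfe.1 dff.1 sol (saddle _ _ _ _ _ sol').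
  split.
    move=> i; apply: (H1_ip_eq0 openO (UH _ Ue i)).
    apply: le_trans (vH1_ip_ge openO i (UH _ Ue)) _.
    (* By Korn's inequality zero elastic energy means zero $H^1$ norm. *)
    by rewrite -(pmulr_rle0 _ (exprn_gt0 2 k_gt0)) (le_trans (a_ge _ Ue)).
  apply: (H1_ip_eq0 openO (VH _ Vr)).
  by rewrite -(pmulr_rle0 _ c1_gt0) (le_trans (c_ge _ (VH _ Vr))).
move=> fe fe' ff ff' g g' u u' p p' [dfe dff Hg _] [dfe' dff' Hg' _] sol sol'.
exact: (obstacle_saddle_point_lipschitz_inf subU gamma_linear subV aP cP blinl blinr b_le
  dfe dfe' dff dff' (saddle _ _ _ _ _ sol) (saddle _ _ _ _ _ sol')
  (gamma_onto g Hg) (gamma_onto g' Hg')).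
Qed.
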